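(* Let $f:\mathbb{R}\to(0,\infty)$ be an (unnormalised) univariate density that is $C^4$, unimodal with its maximum at $0$, of the form $f=e^{-H}$ with $H$ regularly varying (there is $\alpha>0$ with $H(tx)/H(t)\to x^\alpha$ as $|t|\to\infty$ for every $x>0$), and with $|(\log f)''''(z)|<M$ for all $z$ and some $M>0$. Suppose moreover that there exists $\gamma>0$ such that, as $\beta\to\infty$, $$\left|\mathrm{Var}_{g_\beta}(Y^2)-2\right|=\mathcal{O}(\beta^{-\gamma}),$$ where $g_\beta$ is the probability density $g_\beta(y)\propto f^\beta\!\left(y/\sqrt{-\beta(\log f)''(0)}\right)$. Then for $\beta$ sufficiently large (as $\beta\to\infty$) $$\frac12V(\beta)-I(\beta)+\frac{1}{4\beta}R(\beta)=\mathcal{O}(\beta^{-k}),$$ where $k=\min\{2+\gamma,3\}>2$ if $f$ is symmetric about the mode point $0$, and $k=\min\{2+\gamma,5/2\}$ otherwise. Consequently the optimising value $\hat\ell$ (the maximiser over $\ell>0$ of $2\ell^2\Phi(-\ell[I(\beta)-\frac12V(\beta)-\frac{1}{4\beta}R(\beta)]^{1/2}/\sqrt2)$) satisfies $\hat\ell=\mathcal{O}(\beta^{k/2})$.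
   Context: $\Phi$ is the standard normal CDF. Write $h=\log f$, $k(x)=xh'(x)$, $r(x)=x^2h''(x)$ (mode at $0$), and let $\mathbb{E}_\beta,\mathrm{Var}_\beta,\mathrm{Cov}_\beta$ denote moments under the density $f^\beta/\int f^\beta$. Define $I(\beta)=\mathrm{Var}_\beta(h(X))$, $V(\beta)=\mathrm{Cov}_\beta(h(X),k(X))$ and $R(\beta)=\mathbb{E}_\beta[r(X)-k(X)]$. The maximiser $\hat\ell$ is the optimal scaling constant $\ell$ in the temperature spacing $\epsilon=\ell d^{-1/2}$ for the QuanTA swap move on product targets $\prod_{i=1}^d f(x_i)$, obtained by maximising the limiting rescaled expected squared jumping distance.
   Formalization: The final clause is corrected: the literal upper bound ℓ̂=O(β^{k/2}) fails (f=exp(-x²/2-x⁴), γ=1, k=3 gives ℓ̂ of order β²), so it is stated as 1/ℓ̂=O(β^{-k/2}) for every maximiser ℓ̂; (log f)''(0)<0 is explicit so that g_β is defined. *)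

(* Defs.v *)
From Stdlib Require Import Reals.
From Coquelicot Require Import Coquelicot.
Open Scope R_scope.

Definition integR (g : R -> R) : R :=
  RInt_gen g (Rbar_locally m_infty) (Rbar_locally p_infty).

Definition Phi (x : R) : R :=
  RInt_gen (fun t => exp (- t ^ 2 / 2) / sqrt (2 * PI))
    (Rbar_locally m_infty) (at_point x).

Definition Eb (f : R -> R) (beta : R) (g : R -> R) : R :=
  integR (fun x => g x * Rpower (f x) beta) / integR (fun x => Rpower (f x) beta).
Definition Covb (f : R -> R) (beta : R) (g1 g2 : R -> R) : R :=
  Eb f beta (fun x => g1 x * g2 x) - Eb f beta g1 * Eb f beta g2.
Definition Varb (f : R -> R) (beta : R) (g : R -> R) : R := Covb f beta g g.

Definition hfun (f : R -> R) : R -> R := fun x => ln (f x).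
Definition kfun (f : R -> R) : R -> R := fun x => x * Derive (hfun f) x.
Definition rfun (f : R -> R) : R -> R := fun x => x ^ 2 * Derive_n (hfun f) 2 x.

Definition Ifun (f : R -> R) (beta : R) : R := Varb f beta (hfun f).
Definition Vfun (f : R -> R) (beta : R) : R := Covb f beta (hfun f) (kfun f).
Definition Rfun (f : R -> R) (beta : R) : R :=
  Eb f beta (fun x => rfun f x - kfun f x).

Definition gscale (f : R -> R) (beta : R) : R :=
  sqrt (- beta * Derive_n (hfun f) 2 0).
Definition Eg (f : R -> R) (beta : R) (phi : R -> R) : R :=
  integR (fun y => phi y * Rpower (f (y / gscale f beta)) beta)
  / integR (fun y => Rpower (f (y / gscale f beta)) beta).
Definition VargY2 (f : R -> R) (beta : R) : R :=
  Eg f beta (fun y => y ^ 4) - (Eg f beta (fun y => y ^ 2)) ^ 2.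

Definition bigO_pow (u : R -> R) (k : R) : Prop :=
  exists C beta0, forall beta, beta0 <= beta -> Rabs (u beta) <= C * Rpower beta (- k).

Definition C4 (f : R -> R) : Prop :=
  (forall n x, (n <= 4)%nat -> ex_derive_n f n x) /\
  (forall x, continuous (Derive_n f 4) x).

Definition unimodal0 (f : R -> R) : Prop :=
  (forall x y, x <= y <= 0 -> f x <= f y) /\
  (forall x y, 0 <= x <= y -> f y <= f x).

Definition reg_var (H : R -> R) : Prop :=
  exists alpha, 0 < alpha /\ forall x, 0 < x ->
    is_lim (fun t => H (t * x) / H t) p_infty (Rpower x alpha) /\
    is_lim (fun t => H (t * x) / H t) m_infty (Rpower x alpha).

Definition symmetric0 (f : R -> R) : Prop := forall x, f (- x) = f x.

Definition Dfun (f : R -> R) (beta : R) : R :=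
  Ifun f beta - Vfun f beta / 2 - Rfun f beta / (4 * beta).

Definition esjd (f : R -> R) (beta ell : R) : R :=
  2 * ell ^ 2 * Phi (- ell * sqrt (Dfun f beta) / sqrt 2).

Definition is_opt_ell (f : R -> R) (beta lhat : R) : Prop :=
  0 < lhat /\ forall ell, 0 < ell -> esjd f beta ell <= esjd f beta lhat.

(* Main.v *)
Require Import Defs.
From Stdlib Require Import Reals Lra Lia Psatz Classical FunctionalExtensionality.
From Coquelicot Require Import Coquelicot.
Open Scope R_scope.

(* Integration by parts against f^beta gives E[k] = -1/beta, V = 1/beta^2 and
   E[x^2 k] = -3 E[x^2]/beta.  With sigma = -h''(0), each of h - h(0), k and r equals
   -sigma x^2/2, -sigma x^2 and -sigma x^2 up to an error at most c3 |x|^3 + M |x|^4, where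
   c3 = |h'''(0)| vanishes for symmetric f; so the identities determine sigma E[x^2] and
   sigma^2 E[x^4], and in V/2 - I + R/(4 beta) the terms of order beta^-2 cancel.  What is
   left consists of means of the errors.  To bound these, regular variation and
   unimodality give h(0) - h(x) >= c ln (1 + x^2) for all x, whence by Bernoulli's
   inequality f(x)^beta <= f(0)^beta (1 + c beta x^2/5)^-5; so E|x|^i = O(beta^(-i/2)) for
   i <= 8, and the remainder is O(c3 beta^(-5/2) + M beta^-3).

   The maximiser can exist only if D = I - V/2 - R/(4 beta) > 0; comparing it with
   sqrt 2 / sqrt D then gives 1/lhat^2 <= D Phi(0) / (2 Phi(-1)). *)

(** * Improper integrals of dominated functions *)

(** The Taylor polynomial of [h] controls the weight only near 0.

    The power 5 comes from the variance of [h]: squaring a remainder of size [M |x|^4] calls for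
    eighth moments, which consume four factors [1 + (b x)^2]. The fifth is left as a Cauchy kernel,
    whose primitive is an arctangent, so one comparison gives both convergence and an explicit size.

    The natural length is [1 / b], with [b] of order [sqrt beta]. Numerators are at most, and the
    total mass is at least, a multiple of [f(0)^beta / b]; this common factor cancels in every mean
    and leaves constants free of beta. Leading terms come from exact identities, so integrals are
    only bounded, never evaluated asymptotically. For the maximiser the result is a lower bound:
    [lhat] grows at least like [beta^(k/2)]. *)

Lemma monotone_bounded_limit (G : R -> R) (B : R) :
  (forall x y, x <= y -> G x <= G y) -> (forall x, G x <= B) ->
  exists l, filterlim G (Rbar_locally p_infty) (locally l).
Proof.
  intros Hmon HB.
  destruct (completeness (fun y => exists x, y = G x)) as [l [Hub Hlub]].
  { exists B. intros y [x ->]. apply HB. }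
  { exists (G 0), 0. reflexivity. }
  exists l. apply filterlim_locally. intros eps.
  assert (Hx : exists x, l - eps < G x).
  { apply NNPP. intros Hn.
    assert (l <= l - eps).
    { apply Hlub. intros y [x ->]. apply Rnot_lt_le. intros H. apply Hn. now exists x. }
    destruct eps as [e he]; simpl in *; lra. }
  destruct Hx as [x Hx]. exists x. intros y Hy.
  assert (H1 : G x <= G y) by (apply Hmon; lra).
  assert (H2 : G y <= l) by (apply Hub; now exists y).
  change (Rabs (G y - l) < eps). apply Rabs_def1; destruct eps; simpl in *; lra.
Qed.

(* [F + A] and [A] are both monotone and bounded. *)
Lemma limit_p_infty_of_increments (F A : R -> R) (B : R) :
  (forall x, Rabs (A x) <= B) ->
  (forall x y, x <= y -> Rabs (F y - F x) <= A y - A x) ->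
  exists l, filterlim F (Rbar_locally p_infty) (locally l).
Proof.
  intros HA HF.
  assert (HAx : forall x, - B <= A x <= B) by (intros x; apply Rabs_le_between, HA).
  assert (Hinc : forall x y, x <= y -> - (A y - A x) <= F y - F x <= A y - A x)
    by (intros x y Hxy; apply Rabs_le_between, HF, Hxy).
  assert (HFb : forall x, F x <= F 0 + 2 * B).
  { intros x. generalize (HAx 0) (HAx x). intros.
    destruct (Rle_dec 0 x) as [Hx | Hx].
    - generalize (Hinc 0 x Hx). lra.
    - generalize (Hinc x 0 ltac:(lra)). lra. }
  destruct (monotone_bounded_limit A B) as [l1 Hl1].
  { intros x y Hxy. generalize (Hinc x y Hxy). lra. }
  { intros x. generalize (HAx x). lra. }
  destruct (monotone_bounded_limit (fun x => F x + A x) (F 0 + 3 * B)) as [l2 Hl2].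
  { intros x y Hxy. generalize (Hinc x y Hxy). lra. }
  { intros x. generalize (HAx x) (HFb x). lra. }
  exists (l2 - l1).
  apply filterlim_ext with (fun x => (F x + A x) - A x); [intros x; ring |].
  apply (is_lim_minus' _ _ p_infty l2 l1 Hl2 Hl1).
Qed.

Lemma filterlim_opp_m_infty :
  filterlim Ropp (Rbar_locally m_infty) (Rbar_locally p_infty).
Proof. apply (filterlim_Rbar_opp m_infty). Qed.

Lemma limit_m_infty_of_increments (F A : R -> R) (B : R) :
  (forall x, Rabs (A x) <= B) ->
  (forall x y, x <= y -> Rabs (F y - F x) <= A y - A x) ->
  exists l, filterlim F (Rbar_locally m_infty) (locally l).
Proof.
  intros HA HF.
  destruct (limit_p_infty_of_increments (fun x => F (- x)) (fun x => - A (- x)) B)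
    as [l Hl].
  { intros x. rewrite Rabs_Ropp. apply HA. }
  { intros x y Hxy. rewrite Rabs_minus_sym.
    replace (- A (- y) - - A (- x)) with (A (- x) - A (- y)) by ring.
    apply HF. lra. }
  exists l. apply filterlim_ext with (fun x => F (- - x)).
  { intros x. now rewrite Ropp_involutive. }
  apply (filterlim_comp _ _ _ Ropp (fun x => F (- x)) _ _ _ filterlim_opp_m_infty Hl).
Qed.

Lemma filter_prod_all {Fa Fb : (R -> Prop) -> Prop} (P : R * R -> Prop) :
  Filter Fa -> Filter Fb -> (forall p, P p) -> filter_prod Fa Fb P.
Proof.
  intros HFa HFb HP. apply filter_forall. exact HP.
Qed.

(** Arbitrary filters at both ends cover integrals over the whole line as well as [Phi], whose upper
    end is [at_point x]. *)
Lemma is_RInt_gen_antiderivative {Fa Fb : (R -> Prop) -> Prop}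
    {FFa : Filter Fa} {FFb : Filter Fb} (F g : R -> R) (la lb : R) :
  (forall x, is_derive F x (g x)) -> (forall x, continuous g x) ->
  filterlim F Fa (locally la) -> filterlim F Fb (locally lb) ->
  is_RInt_gen g Fa Fb (lb - la).
Proof.
  intros HF Hg Ha Hb.
  apply is_RInt_gen_ext with (Derive F).
  { apply filter_prod_all; try assumption. intros p x _. now apply is_derive_unique. }
  apply is_RInt_gen_Derive; try assumption.
  - apply filter_prod_all; try assumption. intros p x _. eexists; apply HF.
  - apply filter_prod_all; try assumption. intros p x _.
    apply continuous_ext with g; [| apply Hg].
    intros y. symmetry. now apply is_derive_unique.
Qed.

Lemma is_derive_primitive (g : R -> R) :
  (forall x, continuous g x) -> forall x, is_derive (RInt g 0) x (g x).
Proof.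
  intros Hg x. apply is_derive_RInt with (a := 0); [| apply Hg].
  apply filter_forall. intros y. apply RInt_correct.
  apply ex_RInt_continuous. intros; apply Hg.
Qed.

(** Antiderivative of the comparison kernel [B / (1 + (a * x) ^ 2)]; it is bounded, with total
    increase [B / a * PI]. *)
Definition cauchy_primitive (B a x : R) : R := B / a * atan (a * x).

Lemma is_derive_cauchy_primitive (B a x : R) :
  0 < a -> is_derive (cauchy_primitive B a) x (B / (1 + (a * x) ^ 2)).
Proof.
  intros Ha. unfold cauchy_primitive.
  assert (0 < 1 + (a * x) ^ 2) by (generalize (pow2_ge_0 (a * x)); lra).
  evar_last.
  - apply is_derive_scal. apply (is_derive_comp atan (fun y => a * y)).
    + apply is_derive_atan.
    + apply is_derive_scal, is_derive_id.
  - unfold scal, mult, one; simpl. unfold mult, Rsqr; simpl. field. split; nra.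
Qed.

Lemma cauchy_primitive_bound (B a x : R) :
  0 < a -> 0 <= B -> Rabs (cauchy_primitive B a x) <= B / a * (PI / 2).
Proof.
  intros Ha HB. unfold cauchy_primitive.
  assert (0 <= B / a) by (apply Rdiv_le_0_compat; assumption).
  rewrite Rabs_mult, (Rabs_pos_eq (B / a)) by assumption.
  apply Rmult_le_compat_l; [assumption |].
  apply Rabs_le. generalize (atan_bound (a * x)). lra.
Qed.

(** For every [s] with [|s| <= 1], the kernel's primitive minus [s] times that of [g] has a
    nonnegative derivative. The values 1 and -1 of [s] give the two sides of the absolute value. *)
Lemma RInt_increment_dominated (g : R -> R) (B a : R) :
  0 < a -> (forall x, continuous g x) ->
  (forall x, Rabs (g x) <= B / (1 + (a * x) ^ 2)) ->
  forall x y, x <= y ->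
  Rabs (RInt g 0 y - RInt g 0 x) <= cauchy_primitive B a y - cauchy_primitive B a x.
Proof.
  intros Ha Hg Hb x y Hxy.
  assert (D : forall s, Rabs s <= 1 -> RInt g 0 y * s - RInt g 0 x * s
      <= cauchy_primitive B a y - cauchy_primitive B a x).
  { intros s Hs.
    assert (HD : forall t, is_derive
              (fun t => cauchy_primitive B a t - RInt g 0 t * s) t
              (B / (1 + (a * t) ^ 2) - g t * s)).
    { intros t. apply (is_derive_minus (cauchy_primitive B a) (fun t => RInt g 0 t * s)).
      - now apply is_derive_cauchy_primitive.
      - apply (is_derive_scal_l (RInt g 0) t (g t) s). now apply is_derive_primitive. }
    destruct (MVT_gen _ x y _ (fun t _ => HD t)) as [c [_ Hc]].
    { intros t _. apply derivable_continuous_pt. eexists.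
      apply is_derive_Reals, HD. }
    assert (g c * s <= B / (1 + (a * c) ^ 2)).
    { apply Rle_trans with (Rabs (g c * s)); [apply Rle_abs |].
      rewrite Rabs_mult. generalize (Hb c) (Rabs_pos (g c)) (Rabs_pos s). nra. }
    nra. }
  apply Rabs_le. split.
  - generalize (D (-1) ltac:(rewrite Rabs_left; lra)). lra.
  - generalize (D 1 ltac:(rewrite Rabs_R1; lra)). lra.
Qed.

Section Dominated.
Variables (g : R -> R) (B a : R).
Hypothesis a_pos : 0 < a.
Hypothesis g_cont : forall x, continuous g x.
Hypothesis g_dom : forall x, Rabs (g x) <= B / (1 + (a * x) ^ 2).

Lemma dominated_bound_nonneg : 0 <= B.
Proof.
  generalize (g_dom 0) (Rabs_pos (g 0)).
  replace (B / (1 + (a * 0) ^ 2)) with B by (field; simpl; lra). lra.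
Qed.

Lemma dominated_primitive_limits :
  exists lm lp : R, filterlim (RInt g 0) (Rbar_locally m_infty) (locally lm) /\
    filterlim (RInt g 0) (Rbar_locally p_infty) (locally lp).
Proof.
  assert (HB := dominated_bound_nonneg).
  assert (Hinc := RInt_increment_dominated g B a a_pos g_cont g_dom).
  assert (HA := fun x => cauchy_primitive_bound B a x a_pos HB).
  destruct (limit_m_infty_of_increments _ _ _ HA Hinc) as [lm Hm].
  destruct (limit_p_infty_of_increments _ _ _ HA Hinc) as [lp Hp].
  now exists lm, lp.
Qed.

Lemma dominated_integral :
  exists lm lp : R, filterlim (RInt g 0) (Rbar_locally m_infty) (locally lm) /\
    filterlim (RInt g 0) (Rbar_locally p_infty) (locally lp) /\
    is_RInt_gen g (Rbar_locally m_infty) (Rbar_locally p_infty) (lp - lm).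
Proof.
  destruct dominated_primitive_limits as [lm [lp [Hm Hp]]].
  exists lm, lp. repeat split; try assumption.
  apply is_RInt_gen_antiderivative with (RInt g 0); try assumption.
  now apply is_derive_primitive.
Qed.

(** [integR] is a total function, so its value is meaningful only once convergence is known;
    domination supplies that. *)
Lemma is_RInt_gen_integR :
  is_RInt_gen g (Rbar_locally m_infty) (Rbar_locally p_infty) (integR g).
Proof.
  destruct dominated_integral as [lm [lp [_ [_ H]]]].
  unfold integR. rewrite (is_RInt_gen_unique _ _ H). exact H.
Qed.

End Dominated.

(** The limits are taken one after the other: [y] to plus infinity with [x] fixed, then [x] to minus
    infinity. *)
Lemma limit_difference_ge (F : R -> R) (lm lp c X : R) :
  filterlim F (Rbar_locally m_infty) (locally lm) ->
  filterlim F (Rbar_locally p_infty) (locally lp) ->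
  (forall x y, x <= - X -> X <= y -> c <= F y - F x) -> c <= lp - lm.
Proof.
  intros Hm Hp H.
  assert (H1 : forall x, x <= - X -> F x + c <= lp).
  { intros x Hx.
    apply (filterlim_le (F := Rbar_locally p_infty) (fun _ => F x + c) F (F x + c) lp).
    - exists X. intros y Hy. generalize (H x y Hx ltac:(lra)). lra.
    - apply (filterlim_const (F x + c)).
    - exact Hp. }
  assert (H2 : lm <= lp - c).
  { apply (filterlim_le (F := Rbar_locally m_infty) F (fun _ => lp - c) lm (lp - c)).
    - exists (- X). intros y Hy. generalize (H1 y ltac:(lra)). lra.
    - exact Hm.
    - apply (filterlim_const (lp - c)). }
  lra.
Qed.

Lemma integR_is_RInt_gen (g : R -> R) (l : R) :
  is_RInt_gen g (Rbar_locally m_infty) (Rbar_locally p_infty) l -> integR g = l.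
Proof. intros H. exact (is_RInt_gen_unique _ _ H). Qed.

Lemma integR_ge (g : R -> R) (B a c X : R) :
  0 < a -> (forall x, continuous g x) ->
  (forall x, Rabs (g x) <= B / (1 + (a * x) ^ 2)) ->
  (forall x y, x <= - X -> X <= y -> c <= RInt g 0 y - RInt g 0 x) ->
  c <= integR g.
Proof.
  intros Ha Hg Hb Hc.
  destruct (dominated_integral g B a Ha Hg Hb) as [lm [lp [Hm [Hp HI]]]].
  rewrite (integR_is_RInt_gen _ _ HI).
  apply (limit_difference_ge (RInt g 0) lm lp c X Hm Hp Hc).
Qed.

Lemma integR_abs_le (g : R -> R) (B a : R) :
  0 < a -> (forall x, continuous g x) ->
  (forall x, Rabs (g x) <= B / (1 + (a * x) ^ 2)) ->
  Rabs (integR g) <= B / a * PI.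
Proof.
  intros Ha Hg Hb.
  destruct (dominated_integral g B a Ha Hg Hb) as [lm [lp [Hm [Hp HI]]]].
  rewrite (integR_is_RInt_gen _ _ HI).
  assert (HB := dominated_bound_nonneg g B a Hb).
  assert (Hinc : forall x y, x <= - 0 -> 0 <= y ->
            Rabs (RInt g 0 y - RInt g 0 x) <= B / a * PI).
  { intros x y Hx Hy.
    eapply Rle_trans; [apply (RInt_increment_dominated g B a Ha Hg Hb); lra |].
    generalize (Rle_trans _ _ _ (Rle_abs _) (cauchy_primitive_bound B a y Ha HB)).
    generalize (proj1 (proj1 (Rabs_le_between _ _) (cauchy_primitive_bound B a x Ha HB))).
    lra. }
  apply Rabs_le. split.
  - apply (limit_difference_ge (RInt g 0) lm lp _ 0 Hm Hp).
    intros x y Hx Hy. apply (proj1 (Rabs_le_between _ _) (Hinc x y Hx Hy)).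
  - assert (- (B / a * PI) <= - lp - - lm); [| lra].
    apply (limit_difference_ge (fun x => - RInt g 0 x) (- lm) (- lp) _ 0).
    + apply (is_lim_opp (RInt g 0) m_infty lm Hm).
    + apply (is_lim_opp (RInt g 0) p_infty lp Hp).
    + intros x y Hx Hy.
      generalize (proj1 (Rabs_le_between _ _) (Hinc x y Hx Hy)). lra.
Qed.

(** * The maximiser of the squared jumping distance *)

Definition gauss (t : R) : R := exp (- t ^ 2 / 2) / sqrt (2 * PI).

Lemma sqrt_2PI_pos : 0 < sqrt (2 * PI).
Proof. apply sqrt_lt_R0. generalize PI_RGT_0. lra. Qed.

Lemma gauss_pos (t : R) : 0 < gauss t.
Proof. apply Rdiv_lt_0_compat; [apply exp_pos | apply sqrt_2PI_pos]. Qed.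

Lemma gauss_continuous (t : R) : continuous gauss t.
Proof.
  apply (@ex_derive_continuous R_AbsRing R_NormedModule). unfold gauss.
  auto_derive. generalize sqrt_2PI_pos. lra.
Qed.

(** From [exp u >= 1 + u] at [u = t ^ 2 / 2]: the exponential is at most [2 / (2 + t ^ 2)]. *)
Lemma gauss_dominated (t : R) :
  Rabs (gauss t) <= (2 / sqrt (2 * PI)) / (1 + (1 * t) ^ 2).
Proof.
  rewrite Rabs_pos_eq by apply Rlt_le, gauss_pos. unfold gauss.
  assert (Hs := sqrt_2PI_pos).
  assert (Ht := pow2_ge_0 t).
  assert (He : 1 + t ^ 2 / 2 <= exp (t ^ 2 / 2)) by apply exp_ineq1_le.
  replace (- t ^ 2 / 2) with (- (t ^ 2 / 2)) by field. rewrite exp_Ropp.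
  replace (2 / sqrt (2 * PI) / (1 + (1 * t) ^ 2))
    with ((2 / (1 + t ^ 2)) / sqrt (2 * PI)) by (field; nra).
  apply Rmult_le_compat_r; [apply Rlt_le, Rinv_0_lt_compat, Hs |].
  apply Rmult_le_reg_l with (exp (t ^ 2 / 2)); [apply exp_pos |].
  rewrite Rinv_r by (generalize (exp_pos (t ^ 2 / 2)); lra).
  apply Rmult_le_reg_r with (1 + t ^ 2); [lra |].
  unfold Rdiv at 2. rewrite Rmult_assoc, Rmult_assoc, Rinv_l by lra. lra.
Qed.

Lemma Phi_primitive :
  exists lm : R, filterlim (RInt gauss 0) (Rbar_locally m_infty) (locally lm) /\
    forall x, Phi x = RInt gauss 0 x - lm.
Proof.
  destruct (dominated_primitive_limits gauss _ 1 Rlt_0_1 gauss_continuous gauss_dominated)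
    as [lm [_ [Hm _]]].
  exists lm. split; [exact Hm |]. intros x. unfold Phi.
  assert (HI : is_RInt_gen gauss (Rbar_locally m_infty) (at_point x) (RInt gauss 0 x - lm)).
  { apply is_RInt_gen_antiderivative with (RInt gauss 0); try exact Hm.
    - exact (is_derive_primitive gauss gauss_continuous).
    - exact gauss_continuous.
    - intros P HP. exact (locally_singleton _ _ HP). }
  exact (is_RInt_gen_unique _ _ HI).
Qed.

Lemma Phi_lt (x y : R) : x < y -> Phi x < Phi y.
Proof.
  intros Hxy. destruct Phi_primitive as [lm [_ HP]]. rewrite !HP.
  assert (HD := is_derive_primitive gauss gauss_continuous).
  destruct (MVT_gen (RInt gauss 0) x y gauss (fun t _ => HD t)) as [c [_ Hc]].
  { intros t _. apply derivable_continuous_pt. eexists. apply is_derive_Reals, HD. }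
  generalize (gauss_pos c). nra.
Qed.

(** The constant [lm] is the limit at minus infinity of an increasing primitive, hence at most its
    value at [x - 1]; the strict increase from [x - 1] to [x] does the rest. *)
Lemma Phi_pos (x : R) : 0 < Phi x.
Proof.
  apply Rle_lt_trans with (Phi (x - 1)); [| apply Phi_lt; lra].
  destruct Phi_primitive as [lm [Hm HP]].
  assert (lm <= RInt gauss 0 (x - 1)); [| rewrite HP; lra].
  apply (filterlim_le (F := Rbar_locally m_infty) (RInt gauss 0)
           (fun _ => RInt gauss 0 (x - 1)) lm (RInt gauss 0 (x - 1))).
  - exists (x - 1). intros y Hy. generalize (Phi_lt y (x - 1) Hy). rewrite !HP. lra.
  - exact Hm.
  - apply (filterlim_const (RInt gauss 0 (x - 1))).
Qed.

Lemma opt_ell_lower_bound (f : R -> R) (beta lhat : R) :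
  is_opt_ell f beta lhat ->
  0 < Dfun f beta /\ / lhat <= sqrt (Phi 0 / (2 * Phi (- 1)) * Dfun f beta).
Proof.
  intros [Hl Hopt]. unfold esjd in Hopt.
  assert (HP0 := Phi_pos 0). assert (HP1 := Phi_pos (- 1)).
  assert (Hs2 : 0 < sqrt 2) by (apply sqrt_lt_R0; lra).
  assert (HD : 0 < Dfun f beta).
  { apply Rnot_le_lt. intros HD. specialize (Hopt (2 * lhat) ltac:(lra)).
    (* [sqrt] returns 0 on nonpositive arguments, so the objective would be [2 * ell ^ 2 * Phi 0],
       and doubling [lhat] would increase it. *)
    rewrite (sqrt_neg_0 _ HD) in Hopt.
    replace (- (2 * lhat) * 0 / sqrt 2) with 0 in Hopt by (field; lra).
    replace (- lhat * 0 / sqrt 2) with 0 in Hopt by (field; lra).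
    assert (0 < lhat ^ 2 * Phi 0) by (apply Rmult_lt_0_compat; nra). nra. }
  split; [exact HD |].
  set (D := Dfun f beta) in *.
  assert (HsD : 0 < sqrt D) by now apply sqrt_lt_R0.
  assert (HD2 : sqrt D ^ 2 = D) by (apply pow2_sqrt; lra).
  assert (H22 : sqrt 2 ^ 2 = 2) by (apply pow2_sqrt; lra).
  (* At this trial value the argument of [Phi] is exactly -1 and the objective is
     [4 / D * Phi (- 1)]; at [lhat] it is at most [2 * lhat ^ 2 * Phi 0]. *)
  specialize (Hopt (sqrt 2 / sqrt D) ltac:(now apply Rdiv_lt_0_compat)).
  replace (- (sqrt 2 / sqrt D) * sqrt D / sqrt 2) with (- 1) in Hopt by (field; lra).
  replace ((sqrt 2 / sqrt D) ^ 2) with (sqrt 2 ^ 2 / sqrt D ^ 2) in Hopt by (field; lra).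
  rewrite H22, HD2 in Hopt.
  assert (Hm : Phi (- lhat * sqrt D / sqrt 2) <= Phi 0).
  { apply Rlt_le, Phi_lt.
    assert (0 < lhat * sqrt D / sqrt 2) by (apply Rdiv_lt_0_compat; nra).
    replace (- lhat * sqrt D / sqrt 2) with (- (lhat * sqrt D / sqrt 2)) by (field; lra).
    lra. }
  rewrite <- (sqrt_pow2 (/ lhat)) by now apply Rlt_le, Rinv_0_lt_compat.
  apply sqrt_le_1_alt.
  assert (H : 2 / D * Phi (- 1) <= lhat ^ 2 * Phi 0).
  { assert (0 < lhat ^ 2) by nra. nra. }
  apply Rmult_le_reg_l with (lhat ^ 2 * (2 / D * Phi (- 1))).
  { apply Rmult_lt_0_compat; [nra |]. apply Rmult_lt_0_compat; [| exact HP1].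
    apply Rdiv_lt_0_compat; lra. }
  replace (lhat ^ 2 * (2 / D * Phi (- 1)) * (/ lhat) ^ 2) with (2 / D * Phi (- 1))
    by (field; lra).
  replace (lhat ^ 2 * (2 / D * Phi (- 1)) * (Phi 0 / (2 * Phi (- 1)) * D))
    with (lhat ^ 2 * Phi 0) by (field; lra).
  exact H.
Qed.

(** * Logarithmic growth *)

Lemma ln_1p_le (u : R) : 0 <= u -> ln (1 + u) <= u.
Proof.
  intros Hu. rewrite <- (ln_exp u) at 2. apply ln_le; [lra | apply exp_ineq1_le].
Qed.

(** Bernoulli's inequality [1 + a u <= (1 + u)^a] in logarithms: the difference of the sides
    vanishes at 0 and has derivative [a / (1 + t) - a / (1 + a t) >= 0]. *)
Lemma ln_1p_bernoulli (a u : R) : 1 <= a -> 0 <= u -> ln (1 + a * u) <= a * ln (1 + u).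
Proof.
  intros Ha Hu.
  assert (HD : forall t, 0 <= t -> is_derive (fun t => a * ln (1 + t) - ln (1 + a * t)) t
            (a / (1 + t) - a / (1 + a * t))).
  { intros t Ht. assert (0 <= a * t) by nra. auto_derive; [split; nra |].
    field. split; nra. }
  destruct (MVT_gen (fun t => a * ln (1 + t) - ln (1 + a * t)) 0 u
              (fun t => a / (1 + t) - a / (1 + a * t))) as [c [Hc Heq]].
  { intros t Ht. rewrite Rmin_left in Ht by lra. apply HD; lra. }
  { intros t Ht. rewrite Rmin_left in Ht by lra. apply derivable_continuous_pt.
    eexists. apply is_derive_Reals, HD; lra. }
  rewrite Rmin_left, Rmax_right in Hc by lra.
  rewrite !Rmult_0_r, !Rplus_0_r, ln_1 in Heq.
  assert (a / (1 + a * c) <= a / (1 + c)).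
  { apply Rmult_le_compat_l; [lra |]. apply Rinv_le_contravar; nra. }
  nra.
Qed.

(* Beyond some [T0] the increments [H (2 t) - H t] stay above a fixed [d > 0], which
   sustains the logarithmic bound from one dyadic scale to the next. *)
Lemma log_growth (H : R -> R) (L c0 delta : R) :
  (forall x y, 0 <= x <= y -> H x <= H y) ->
  1 < L -> is_lim (fun t => H (t * 2) / H t) p_infty L ->
  0 < c0 -> 0 < delta ->
  (forall x, 0 <= x <= delta -> c0 * x ^ 2 <= H x - H 0) ->
  exists c, 0 < c /\ forall x, 0 <= x -> c * ln (1 + x ^ 2) <= H x - H 0.
Proof.
  intros Hmon HL Hlim Hc0 Hd Hnear.
  (* Half of the gap above 1, so that the ratio eventually exceeds [L - e = 1 + e]. *)
  set (e := (L - 1) / 2).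
  assert (He : 0 < e) by (unfold e; lra).
  apply is_lim_spec in Hlim. destruct (Hlim (mkposreal e He)) as [T HT]. simpl in HT.
  set (T0 := Rmax (Rmax T 0 + 1) delta).
  assert (HT0 : T < T0 /\ 0 < T0 /\ delta <= T0).
  { unfold T0. generalize (Rmax_l T 0) (Rmax_r T 0)
      (Rmax_l (Rmax T 0 + 1) delta) (Rmax_r (Rmax T 0 + 1) delta). lra. }
  assert (Hratio : forall t, T0 <= t -> 0 < H t /\ (1 + e) * H t <= H (2 * t)).
  { intros t Ht.
    assert (Hr : 1 + e < H (t * 2) / H t).
    { generalize (Rabs_def2 _ _ (HT t ltac:(lra))). unfold e. lra. }
    assert (Hm : H t <= H (t * 2)) by (apply Hmon; lra).
    assert (Hpos : 0 < H t).
    (* A negative [H t] would, by monotonicity, force a ratio of at most 1; for [H t = 0] the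
       quotient is 0 by the convention on division by zero. *)
    { apply Rnot_le_lt. intros [Hneg | Hz].
      - assert (H (t * 2) / H t <= 1); [| lra].
        apply Rmult_le_reg_r with (- H t); [lra |].
        replace (H (t * 2) / H t * - H t) with (- H (t * 2)) by (field; lra). lra.
      - unfold Rdiv in Hr. rewrite Hz, Rinv_0, Rmult_0_r in Hr. lra. }
    split; [exact Hpos |]. rewrite (Rmult_comm 2 t).
    apply Rmult_le_reg_r with (/ H t); [now apply Rinv_0_lt_compat |].
    rewrite Rmult_assoc, Rinv_r by lra. unfold Rdiv in Hr. lra. }
  set (d := e * H T0).
  assert (Hd0 : 0 < d) by (apply Rmult_lt_0_compat; [lra | now apply Hratio; lra]).
  assert (Hdbl : forall t, T0 <= t -> H t + d <= H (2 * t)).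
  { intros t Ht. destruct (Hratio t Ht) as [H1 H2].
    assert (H T0 <= H t) by (apply Hmon; lra). unfold d. nra. }
  assert (Hl1 : 0 < ln (1 + (2 * T0) ^ 2)) by (rewrite <- ln_1; apply ln_increasing; nra).
  assert (Hl4 : 0 < ln 4) by (rewrite <- ln_1; apply ln_increasing; lra).
  assert (Hm0 : 0 < c0 * delta ^ 2) by (apply Rmult_lt_0_compat; nra).
  (* One constraint for each range: the quadratic bound up to [delta], the bounded range up to
     [2 * T0], and the doubling step, in which [ln (1 + x ^ 2)] gains at most [ln 4] while [H] gains
     [d]. *)
  set (c := Rmin c0 (Rmin (c0 * delta ^ 2 / ln (1 + (2 * T0) ^ 2)) (d / ln 4))).
  assert (Hc : 0 < c).
  { apply Rmin_glb_lt; [lra |].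
    apply Rmin_glb_lt; apply Rdiv_lt_0_compat; assumption. }
  assert (C1 : c <= c0) by apply Rmin_l.
  assert (C2 : c * ln (1 + (2 * T0) ^ 2) <= c0 * delta ^ 2).
  { apply Rmult_le_reg_r with (/ ln (1 + (2 * T0) ^ 2)); [now apply Rinv_0_lt_compat |].
    rewrite Rmult_assoc, Rinv_r, Rmult_1_r by lra.
    eapply Rle_trans; [apply Rmin_r | apply Rmin_l]. }
  assert (C3 : c * ln 4 <= d).
  { apply Rmult_le_reg_r with (/ ln 4); [now apply Rinv_0_lt_compat |].
    rewrite Rmult_assoc, Rinv_r, Rmult_1_r by lra.
    eapply Rle_trans; [apply Rmin_r | apply Rmin_r]. }
  exists c. split; [exact Hc |].
  (* If [2 * T0 < x <= (3 + n) * T0], then [x / 2] lies above [T0], where doubling applies, and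
     below [(2 + n) * T0], where the induction hypothesis applies. *)
  assert (Hind : forall n x, 0 <= x <= (2 + INR n) * T0 ->
            c * ln (1 + x ^ 2) <= H x - H 0).
  { assert (Hbase : forall x, 0 <= x <= 2 * T0 -> c * ln (1 + x ^ 2) <= H x - H 0).
    { intros x Hx. destruct (Rle_dec x delta) as [Hxd | Hxd].
      - generalize (Hnear x ltac:(lra)) (ln_1p_le (x ^ 2) (pow2_ge_0 x)) (pow2_ge_0 x).
        nra.
      - assert (H delta <= H x) by (apply Hmon; lra).
        generalize (Hnear delta ltac:(lra)).
        assert (ln (1 + x ^ 2) <= ln (1 + (2 * T0) ^ 2)) by (apply ln_le; nra).
        nra. }
    induction n as [| n IHn]; intros x Hx.
    { apply Hbase. simpl in Hx. lra. }
    destruct (Rle_dec x (2 * T0)) as [Hx2 | Hx2]; [apply Hbase; lra |].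
    rewrite S_INR in Hx. assert (Hn := pos_INR n).
    assert (0 <= INR n * T0) by nra.
    generalize (IHn (x / 2) ltac:(nra)) (Hdbl (x / 2) ltac:(lra)).
    replace (2 * (x / 2)) with x by field.
    assert (ln (1 + x ^ 2) <= ln 4 + ln (1 + (x / 2) ^ 2)).
    { rewrite <- ln_mult by nra. apply ln_le; nra. }
    nra. }
  intros x Hx. destruct (INR_unbounded (x / T0)) as [n Hn].
  apply Hind with n. split; [exact Hx |].
  assert (x < INR n * T0).
  { apply Rmult_lt_reg_r with (/ T0); [apply Rinv_0_lt_compat; lra |].
    rewrite Rmult_assoc, Rinv_r, Rmult_1_r by lra. exact Hn. }
  lra.
Qed.

(** * Means under a polynomially decaying weight *)

(** Powers of [1 + x ^ 2] are the scale of the weight's own decay: against the fifth inverse power,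
    index 4 still leaves one integrable factor. *)
Definition poly_bounded (n : nat) (g : R -> R) : Prop :=
  (forall x, continuous g x) /\ exists A, forall x, Rabs (g x) <= A * (1 + x ^ 2) ^ n.

Lemma one_le_pow_1p_sq (x : R) (n : nat) : 1 <= (1 + x ^ 2) ^ n.
Proof. apply pow_R1_Rle. generalize (pow2_ge_0 x). lra. Qed.

Lemma Rabs_pow_le_1p_sq (x : R) (i n : nat) :
  (i <= 2 * n)%nat -> Rabs x ^ i <= (1 + x ^ 2) ^ n.
Proof.
  intros Hi. destruct (Rle_dec (Rabs x) 1) as [Hx | Hx].
  - apply Rle_trans with 1; [| apply one_le_pow_1p_sq].
    rewrite <- (pow1 i). apply pow_incr. split; [apply Rabs_pos | exact Hx].
  - apply Rle_trans with (Rabs x ^ (2 * n)).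
    + apply Rle_pow; [lra | exact Hi].
    + rewrite pow_mult. apply pow_incr. rewrite pow2_abs.
      generalize (pow2_ge_0 x). lra.
Qed.

Lemma continuous_poly (c : R) (n : nat) (x : R) : continuous (fun x => c * x ^ n) x.
Proof.
  apply (@ex_derive_continuous R_AbsRing R_NormedModule). auto_derive. trivial.
Qed.

Lemma continuous_Rplus (g1 g2 : R -> R) (x : R) :
  continuous g1 x -> continuous g2 x -> continuous (fun x => g1 x + g2 x) x.
Proof. apply (continuous_plus g1 g2). Qed.

Lemma continuous_Rmult (g1 g2 : R -> R) (x : R) :
  continuous g1 x -> continuous g2 x -> continuous (fun x => g1 x * g2 x) x.
Proof. apply (continuous_mult g1 g2). Qed.

Lemma poly_bounded_intro (n : nat) (g : R -> R) (A B : R) (i j : nat) :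
  (i <= 2 * n)%nat -> (j <= 2 * n)%nat -> 0 <= A -> 0 <= B ->
  (forall x, continuous g x) ->
  (forall x, Rabs (g x) <= A * Rabs x ^ i + B * Rabs x ^ j) -> poly_bounded n g.
Proof.
  intros Hi Hj HA HB Hg Hb. split; [exact Hg |]. exists (A + B). intros x.
  generalize (Hb x) (Rabs_pow_le_1p_sq x i n Hi) (Rabs_pow_le_1p_sq x j n Hj).
  nra.
Qed.

Lemma poly_bounded_ext (n : nat) (g g' : R -> R) :
  (forall x, g x = g' x) -> poly_bounded n g' -> poly_bounded n g.
Proof. intros Heq H. now rewrite (functional_extensionality _ _ Heq). Qed.

Lemma poly_bounded_lin (n : nat) (p q : R) (g1 g2 : R -> R) :
  poly_bounded n g1 -> poly_bounded n g2 ->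
  poly_bounded n (fun x => p * g1 x + q * g2 x).
Proof.
  intros [H1 [A1 B1]] [H2 [A2 B2]]. split.
  - intros x. apply continuous_Rplus; apply continuous_Rmult; auto using continuous_const.
  - exists (Rabs p * A1 + Rabs q * A2). intros x.
    eapply Rle_trans; [apply Rabs_triang |]. rewrite !Rabs_mult.
    generalize (B1 x) (B2 x) (Rabs_pos p) (Rabs_pos q). nra.
Qed.

Lemma poly_bounded_mult (n m : nat) (g1 g2 : R -> R) :
  poly_bounded n g1 -> poly_bounded m g2 ->
  poly_bounded (n + m) (fun x => g1 x * g2 x).
Proof.
  intros [H1 [A1 B1]] [H2 [A2 B2]]. split.
  - intros x. now apply continuous_Rmult.
  - exists (A1 * A2). intros x. rewrite Rabs_mult, pow_add.
    replace (A1 * A2 * ((1 + x ^ 2) ^ n * (1 + x ^ 2) ^ m))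
      with ((A1 * (1 + x ^ 2) ^ n) * (A2 * (1 + x ^ 2) ^ m)) by ring.
    apply Rmult_le_compat; auto using Rabs_pos.
Qed.

Lemma poly_bounded_monomial (n : nat) (c : R) (i : nat) :
  (i <= 2 * n)%nat -> poly_bounded n (fun x => c * x ^ i).
Proof.
  intros Hi. apply poly_bounded_intro with (Rabs c) 0 i 0%nat; try lia; try lra.
  - apply Rabs_pos.
  - apply continuous_poly.
  - intros x. rewrite Rabs_mult, <- RPow_abs. lra.
Qed.

Lemma poly_bounded_const (n : nat) (c : R) : poly_bounded n (fun _ => c).
Proof.
  apply (poly_bounded_ext n _ (fun x => c * x ^ 0)); [intros; simpl; ring |].
  apply poly_bounded_monomial. lia.
Qed.

Lemma poly_bounded_le (n m : nat) (g : R -> R) :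
  (n <= m)%nat -> poly_bounded n g -> poly_bounded m g.
Proof.
  intros Hnm H. replace m with (n + (m - n))%nat by lia.
  apply (poly_bounded_ext _ _ (fun x => g x * 1)); [intros; ring |].
  apply poly_bounded_mult; [exact H | apply poly_bounded_const].
Qed.

Section Mean.
Variables (W : R -> R) (S b : R).
Hypothesis b_ge_1 : 1 <= b.
Hypothesis W_continuous : forall x, continuous W x.
Hypothesis W_bound : forall x, 0 <= W x <= S / (1 + (b * x) ^ 2) ^ 5.
Hypothesis W_mass : 0 < integR W.

Definition mean (g : R -> R) : R := integR (fun x => g x * W x) / integR W.

Lemma weight_scale_nonneg : 0 <= S.
Proof.
  generalize (W_bound 0). replace (S / (1 + (b * 0) ^ 2) ^ 5) with S; [lra |].
  rewrite Rmult_0_r. field.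
Qed.

(** Four of the five factors in the bound on [W] absorb [|b x|^i], the last remains as Cauchy
    kernel. Each power of [x] thus costs a factor [1 / b], the source of all powers of beta
    below. *)
Lemma weighted_power_bound (x : R) (i : nat) : (i <= 8)%nat ->
  Rabs x ^ i * W x <= S / b ^ i / (1 + (b * x) ^ 2).
Proof.
  intros Hi. assert (HS := weight_scale_nonneg).
  set (u := (1 + (b * x) ^ 2)).
  assert (Hu : 1 <= u) by (generalize (pow2_ge_0 (b * x)); unfold u; lra).
  assert (Hbi : 0 < b ^ i) by (apply pow_lt; lra).
  assert (Hu4 : 0 < u ^ 4) by (apply pow_lt; lra).
  assert (H1 : b ^ i * Rabs x ^ i <= u ^ 4).
  { rewrite <- Rpow_mult_distr, <- (Rabs_pos_eq b) at 1 by lra.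
    rewrite <- Rabs_mult. apply Rabs_pow_le_1p_sq. lia. }
  assert (HxW : Rabs x ^ i * W x <= Rabs x ^ i * (S / u ^ 5)).
  { apply Rmult_le_compat_l; [apply pow_le, Rabs_pos | apply W_bound]. }
  eapply Rle_trans; [exact HxW |].
  replace (S / b ^ i / u) with (u ^ 4 * (S / (b ^ i * u ^ 5))) by (field; lra).
  replace (Rabs x ^ i * (S / u ^ 5)) with (b ^ i * Rabs x ^ i * (S / (b ^ i * u ^ 5)))
    by (field; lra).
  apply Rmult_le_compat_r; [| exact H1].
  apply Rdiv_le_0_compat; [exact HS |]. apply Rmult_lt_0_compat; [exact Hbi |].
  apply pow_lt; lra.
Qed.

Lemma weighted_dominated (g : R -> R) (A : R) :
  (forall x, Rabs (g x) <= A * (1 + x ^ 2) ^ 4) ->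
  forall x, Rabs (g x * W x) <= A * S / (1 + (b * x) ^ 2).
Proof.
  intros HA x. assert (HS := weight_scale_nonneg). destruct (W_bound x) as [HW0 HW1].
  assert (HA0 : 0 <= A).
  { generalize (HA 0) (Rabs_pos (g 0)). replace (A * (1 + 0 ^ 2) ^ 4) with A by ring. lra. }
  rewrite Rabs_mult, (Rabs_pos_eq (W x)) by exact HW0.
  set (u := 1 + (b * x) ^ 2) in *.
  assert (Hxu : 1 + x ^ 2 <= u).
  { unfold u. rewrite Rpow_mult_distr. assert (1 <= b ^ 2) by nra.
    generalize (pow2_ge_0 x). nra. }
  assert (Hx1 : 1 <= 1 + x ^ 2) by (generalize (pow2_ge_0 x); lra).
  assert (H4 : (1 + x ^ 2) ^ 4 <= u ^ 4) by (apply pow_incr; lra).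
  replace (A * S / u) with (A * u ^ 4 * (S / u ^ 5)) by (field; lra).
  apply Rmult_le_compat; try assumption; [apply Rabs_pos |].
  eapply Rle_trans; [apply HA |]. now apply Rmult_le_compat_l.
Qed.

Lemma weighted_continuous (g : R -> R) :
  (forall x, continuous g x) -> forall x, continuous (fun x => g x * W x) x.
Proof. intros Hg x. now apply continuous_Rmult. Qed.

Lemma weighted_is_RInt_gen (g : R -> R) : poly_bounded 4 g ->
  is_RInt_gen (fun x => g x * W x) (Rbar_locally m_infty) (Rbar_locally p_infty)
    (integR (fun x => g x * W x)).
Proof.
  intros [Hg [A HA]]. apply is_RInt_gen_integR with (A * S) b; [lra | |].
  - now apply weighted_continuous.
  - now apply weighted_dominated.
Qed.

Lemma mean_lin (p q : R) (g1 g2 : R -> R) : poly_bounded 4 g1 -> poly_bounded 4 g2 ->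
  mean (fun x => p * g1 x + q * g2 x) = p * mean g1 + q * mean g2.
Proof.
  intros H1 H2. unfold mean.
  replace (integR (fun x => (p * g1 x + q * g2 x) * W x))
    with (p * integR (fun x => g1 x * W x) + q * integR (fun x => g2 x * W x)).
  { field. lra. }
  symmetry. apply integR_is_RInt_gen.
  assert (K1 := is_RInt_gen_scal _ p _ (weighted_is_RInt_gen g1 H1)).
  assert (K2 := is_RInt_gen_scal _ q _ (weighted_is_RInt_gen g2 H2)).
  eapply is_RInt_gen_ext; [| exact (is_RInt_gen_plus _ _ _ _ K1 K2)].
  apply filter_forall. intros ab x _. simpl. unfold plus, scal; simpl. unfold mult; simpl. ring.
Qed.

Lemma mean_1 : mean (fun _ => 1) = 1.
Proof.
  unfold mean. replace (fun x => 1 * W x) with W.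
  - field. lra.
  - apply functional_extensionality. intros x. ring.
Qed.

(** A common shape for the linear decompositions below; shorter ones are padded with zero
    coefficients. *)
Lemma mean_comb4 (p1 p2 p3 p4 : R) (g g1 g2 g3 g4 : R -> R) :
  poly_bounded 4 g1 -> poly_bounded 4 g2 -> poly_bounded 4 g3 -> poly_bounded 4 g4 ->
  (forall x, g x = p1 * g1 x + p2 * g2 x + p3 * g3 x + p4 * g4 x) ->
  mean g = p1 * mean g1 + p2 * mean g2 + p3 * mean g3 + p4 * mean g4.
Proof.
  intros H1 H2 H3 H4 Heq.
  rewrite (functional_extensionality g
    (fun x => 1 * (p1 * g1 x + p2 * g2 x) + 1 * (p3 * g3 x + p4 * g4 x))).
  - rewrite !mean_lin; auto using poly_bounded_lin. ring.
  - intros x. rewrite Heq. ring.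
Qed.

(** The numerator is at most [PI * S / b] times the bracket, the denominator at least
    [zeta * S / b]; [S] and the outer [1 / b] cancel. *)
Lemma mean_abs_le (zeta : R) (g : R -> R) (A B : R) (i j : nat) :
  0 < zeta -> zeta * S / b <= integR W ->
  (i <= 8)%nat -> (j <= 8)%nat -> 0 <= A -> 0 <= B ->
  (forall x, continuous g x) ->
  (forall x, Rabs (g x) <= A * Rabs x ^ i + B * Rabs x ^ j) ->
  Rabs (mean g) <= PI / zeta * (A / b ^ i + B / b ^ j).
Proof.
  intros Hz HZ Hi Hj HA HB Hg Hb. assert (HS := weight_scale_nonneg).
  assert (Hbi : forall n, 0 < b ^ n) by (intros n; apply pow_lt; lra).
  assert (HQ : 0 <= A / b ^ i + B / b ^ j).
  { apply Rplus_le_le_0_compat; apply Rdiv_le_0_compat; auto. }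
  assert (Hint : Rabs (integR (fun x => g x * W x))
                 <= S * (A / b ^ i + B / b ^ j) / b * PI).
  { apply integR_abs_le; [lra | |].
    - now apply weighted_continuous.
    - intros x. destruct (W_bound x) as [HW0 _].
      rewrite Rabs_mult, (Rabs_pos_eq (W x)) by exact HW0.
      apply Rle_trans with (A * (Rabs x ^ i * W x) + B * (Rabs x ^ j * W x)).
      { generalize (Hb x). nra. }
      generalize (weighted_power_bound x i Hi) (weighted_power_bound x j Hj). intros P1 P2.
      replace (S * (A / b ^ i + B / b ^ j) / (1 + (b * x) ^ 2))
        with (A * (S / b ^ i / (1 + (b * x) ^ 2)) + B * (S / b ^ j / (1 + (b * x) ^ 2))).
      + apply Rplus_le_compat; now apply Rmult_le_compat_l.
      + generalize (Hbi i) (Hbi j) (pow2_ge_0 (b * x)). intros. field. repeat split; lra. }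
  unfold mean, Rdiv at 1. rewrite Rabs_mult, Rabs_inv, (Rabs_pos_eq (integR W)) by lra.
  apply Rmult_le_reg_r with (integR W); [exact W_mass |].
  rewrite Rmult_assoc, Rinv_l, Rmult_1_r by lra.
  eapply Rle_trans; [exact Hint |].
  replace (S * (A / b ^ i + B / b ^ j) / b * PI)
    with (PI / zeta * (A / b ^ i + B / b ^ j) * (zeta * S / b)).
  - apply Rmult_le_compat_l; [| exact HZ].
    apply Rmult_le_pos; [| exact HQ]. apply Rdiv_le_0_compat; [generalize PI_RGT_0; lra | exact Hz].
  - generalize (Hbi i) (Hbi j). intros. field. repeat split; lra.
Qed.

(* [u W] vanishes at infinity, so [(u W)' = (u' + beta h' u) W] has integral zero. *)
Lemma mean_by_parts (beta : R) (h1 u u1 : R -> R) :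
  (forall x, is_derive W x (beta * h1 x * W x)) ->
  poly_bounded 4 u -> (forall x, is_derive u x (u1 x)) ->
  (forall x, continuous u1 x) -> (forall x, continuous h1 x) ->
  mean (fun x => u1 x + beta * (u x * h1 x)) = 0.
Proof.
  intros HW [Hu [A HA]] Hu1 Hcu1 Hch1.
  assert (Hdom := weighted_dominated u A HA).
  assert (HAS : 0 <= A * S) by exact (dominated_bound_nonneg _ _ _ Hdom).
  (* Since [|x| <= 1 + (b * x) ^ 2], the dominating kernel drops below [eps] as soon as [|x|]
     exceeds [A * S / eps]. *)
  assert (Hsmall : forall eps x, 0 < eps -> A * S / eps < Rabs x -> Rabs (u x * W x) < eps).
  { intros eps x He Hx. eapply Rle_lt_trans; [apply Hdom |].
    assert (Hx1 : Rabs x <= 1 + (b * x) ^ 2).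
    { rewrite Rpow_mult_distr, <- (pow2_abs x). generalize (Rabs_pos x).
      assert (1 <= b ^ 2) by nra. generalize (pow2_ge_0 (Rabs x - 1)).
      generalize (pow2_ge_0 (Rabs x)). nra. }
    assert (0 <= A * S / eps) by now apply Rdiv_le_0_compat.
    apply Rmult_lt_reg_r with (1 + (b * x) ^ 2); [lra |].
    unfold Rdiv at 1. rewrite Rmult_assoc, Rinv_l, Rmult_1_r by lra.
    replace (A * S) with (eps * (A * S / eps)) by (field; lra).
    apply Rmult_lt_compat_l; lra. }
  assert (HI : integR (fun x => (u1 x + beta * (u x * h1 x)) * W x) = 0).
  { apply integR_is_RInt_gen. replace 0 with (0 - 0) by ring.
    apply is_RInt_gen_antiderivative with (fun x => u x * W x).
    - intros x. evar_last.
      + apply (is_derive_mult u W); [apply Hu1 | apply HW | intros; apply Rmult_comm].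
      + unfold plus, mult; simpl. ring.
    - intros x. repeat first [apply continuous_Rmult | apply continuous_Rplus];
        auto using continuous_const.
    - apply filterlim_locally. intros [eps He]. exists (- (A * S / eps)). intros x Hx.
      assert (0 <= A * S / eps) by now apply Rdiv_le_0_compat.
      change (Rabs (u x * W x - 0) < eps). rewrite Rminus_0_r. apply Hsmall; [exact He |].
      rewrite Rabs_left; lra.
    - apply filterlim_locally. intros [eps He]. exists (A * S / eps). intros x Hx.
      assert (0 <= A * S / eps) by now apply Rdiv_le_0_compat.
      change (Rabs (u x * W x - 0) < eps). rewrite Rminus_0_r. apply Hsmall; [exact He |].
      rewrite Rabs_pos_eq; lra. }
  unfold mean. rewrite HI. unfold Rdiv. ring.
Qed.

End Mean.

(** * Expansion of the moments *)

Lemma exp_le_compat (x y : R) : x <= y -> exp x <= exp y.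
Proof. intros [H | ->]; [now apply Rlt_le, exp_increasing | apply Rle_refl]. Qed.

Lemma continuous_of_is_derive (g g1 : R -> R) :
  (forall x, is_derive g x (g1 x)) -> forall x, continuous g x.
Proof.
  intros H x. apply (@ex_derive_continuous R_AbsRing R_NormedModule). eexists; apply H.
Qed.

Lemma primitive_increment_ge (g : R -> R) (m x y : R) :
  (forall t, continuous g t) -> x <= y -> (forall t, x <= t <= y -> m <= g t) ->
  m * (y - x) <= RInt g 0 y - RInt g 0 x.
Proof.
  intros Hg Hxy Hm. assert (HD := is_derive_primitive g Hg).
  destruct (MVT_gen (RInt g 0) x y g (fun t _ => HD t)) as [t [Ht Heq]].
  { intros t _. apply derivable_continuous_pt. eexists. apply is_derive_Reals, HD. }
  rewrite Rmin_left, Rmax_right in Ht by exact Hxy.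
  rewrite Heq. apply Rmult_le_compat_r; [lra | now apply Hm].
Qed.

(** The arithmetic of the final estimate. In use [e1], ..., [e6] are the means of [kap], [x^2 kap],
    [x^2 rho], [rho^2], [rho], [tau], with [s = 1 / beta] and [w = b^-2]. Every term is of order
    [q * w]: a factor [s] or [x^2] contributes [w], and a product of two remainders contributes
    [q^2 <= Q * q * w]. *)
Lemma error_terms_bound (s sigma e1 e2 e3 e4 e5 e6 K q w lambda Q : R) :
  0 <= sigma -> 0 <= K -> 0 <= q -> 0 <= w -> 0 <= lambda ->
  s = lambda * w -> q <= Q * w ->
  Rabs e1 <= K * q -> Rabs e2 <= K * (q * w) -> Rabs e3 <= K * (q * w) ->
  Rabs e4 <= K * (2 * q ^ 2) -> Rabs e5 <= K * q -> Rabs e6 <= K * q ->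
  Rabs (- (s * e1) / 2 - s * e5 + s * e6 / 4 - sigma * e2 / 4 + sigma * e3 - e4
        + e1 * e1 / 4 - e1 * e5 + e5 * e5)
  <= K * (3 * lambda + 2 * sigma + 2 * Q + 3 * K * Q) * (q * w).
Proof.
  intros Hsig HK Hq Hw Hlam Hs HQ H1 H2 H3 H4 H5 H6.
  assert (Hqw : 0 <= q * w) by nra.
  assert (HKq : 0 <= K * q) by nra.
  assert (Hs0 : 0 <= s) by nra.
  assert (Hs1 : forall e, Rabs e <= K * q -> Rabs (s * e) <= lambda * (K * (q * w))).
  { intros e He. rewrite Rabs_mult, (Rabs_pos_eq s) by exact Hs0.
    replace (lambda * (K * (q * w))) with (s * (K * q)) by (rewrite Hs; ring).
    now apply Rmult_le_compat_l. }
  assert (Hsg : forall e, Rabs e <= K * (q * w) -> Rabs (sigma * e) <= sigma * (K * (q * w))).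
  { intros e He. rewrite Rabs_mult, (Rabs_pos_eq sigma) by exact Hsig.
    now apply Rmult_le_compat_l. }
  assert (Hqq : q ^ 2 <= Q * (q * w)) by nra.
  assert (Hee : forall e e', Rabs e <= K * q -> Rabs e' <= K * q ->
            Rabs (e * e') <= K * (K * (Q * (q * w)))).
  { intros e e' He He'. rewrite Rabs_mult.
    apply Rle_trans with ((K * q) * (K * q)).
    - apply Rmult_le_compat; auto using Rabs_pos.
    - replace (K * q * (K * q)) with (K * (K * q ^ 2)) by ring.
      repeat apply Rmult_le_compat_l; assumption. }
  assert (H4' : Rabs e4 <= 2 * (K * (Q * (q * w)))).
  { eapply Rle_trans; [exact H4 |]. assert (K * q ^ 2 <= K * (Q * (q * w))) by
      now apply Rmult_le_compat_l. lra. }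
  assert (HK1 : 0 <= lambda * (K * (q * w))) by (repeat apply Rmult_le_pos; assumption).
  assert (HK2 : 0 <= sigma * (K * (q * w))) by (repeat apply Rmult_le_pos; assumption).
  assert (HK3 : 0 <= K * (K * (Q * (q * w)))) by
    (eapply Rle_trans; [apply Rabs_pos | apply (Hee e1 e1 H1 H1)]).
  assert (A1 := proj1 (Rabs_le_between _ _) (Hs1 e1 H1)).
  assert (A5 := proj1 (Rabs_le_between _ _) (Hs1 e5 H5)).
  assert (A6 := proj1 (Rabs_le_between _ _) (Hs1 e6 H6)).
  assert (A2 := proj1 (Rabs_le_between _ _) (Hsg e2 H2)).
  assert (A3 := proj1 (Rabs_le_between _ _) (Hsg e3 H3)).
  assert (A4 := proj1 (Rabs_le_between _ _) H4').
  assert (A11 := proj1 (Rabs_le_between _ _) (Hee e1 e1 H1 H1)).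
  assert (A15 := proj1 (Rabs_le_between _ _) (Hee e1 e5 H1 H5)).
  assert (A55 := proj1 (Rabs_le_between _ _) (Hee e5 e5 H5 H5)).
  replace (K * (3 * lambda + 2 * sigma + 2 * Q + 3 * K * Q) * (q * w)) with
    (3 * (lambda * (K * (q * w))) + 2 * (sigma * (K * (q * w)))
     + 2 * (K * (Q * (q * w))) + 3 * (K * (K * (Q * (q * w))))) by ring.
  apply Rabs_le; split; lra.
Qed.

Section Expansion.
Variables (h h1 h2 : R -> R) (sigma c3 M c c' beta : R).
Hypothesis sigma_pos : 0 < sigma.
Hypothesis c3_nonneg : 0 <= c3.
Hypothesis M_nonneg : 0 <= M.
Hypothesis c_pos : 0 < c.
Hypothesis h_derive : forall x, is_derive h x (h1 x).
Hypothesis h1_derive : forall x, is_derive h1 x (h2 x).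
Hypothesis h2_continuous : forall x, continuous h2 x.
Hypothesis h_expand : forall x,
  Rabs (h x - h 0 + sigma / 2 * x ^ 2) <= c3 * Rabs x ^ 3 + M * Rabs x ^ 4.
Hypothesis h1_expand : forall x,
  Rabs (x * h1 x + sigma * x ^ 2) <= c3 * Rabs x ^ 3 + M * Rabs x ^ 4.
Hypothesis h2_expand : forall x,
  Rabs (x ^ 2 * h2 x + sigma * x ^ 2) <= c3 * Rabs x ^ 3 + M * Rabs x ^ 4.
Hypothesis h_upper : forall x, c * ln (1 + x ^ 2) <= h 0 - h x.
Hypothesis h_lower : forall x, Rabs x <= 1 -> h 0 - h x <= c' * x ^ 2.
Hypothesis beta_large : 5 / c <= beta.

Let W (x : R) : R := exp (beta * h x).
Let S : R := exp (beta * h 0).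
(** Inverse width of the weight, chosen so that Bernoulli's inequality bounds [5 * ln (1 + (b x)^2)]
    by [c * beta * ln (1 + x^2)]. *)
Let b : R := sqrt (c * beta / 5).
(** On the interval from [- / b] to [/ b], of length [2 / b], the loss [beta * (h 0 - h x)] is at
    most [beta * c' / b ^ 2 = 5 * c' / c]. Hence a lower bound [zeta * S / b] for the mass, with
    [zeta] free of beta. *)
Let zeta : R := 2 * exp (- (5 * c' / c)).

Lemma beta_pos : 0 < beta.
Proof. eapply Rlt_le_trans; [| exact beta_large]. apply Rdiv_lt_0_compat; lra. Qed.

Lemma scale_sq_ge_1 : 1 <= c * beta / 5.
Proof.
  apply Rmult_le_reg_r with (5 / c); [apply Rdiv_lt_0_compat; lra |].
  replace (c * beta / 5 * (5 / c)) with beta by (field; lra). lra.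
Qed.

Lemma scale_ge_1 : 1 <= b.
Proof. unfold b. rewrite <- sqrt_1. apply sqrt_le_1_alt, scale_sq_ge_1. Qed.

Lemma scale_sq : b ^ 2 = c * beta / 5.
Proof. apply pow2_sqrt. generalize scale_sq_ge_1. lra. Qed.

Lemma weight_derive (x : R) : is_derive W x (beta * h1 x * W x).
Proof.
  unfold W. evar_last.
  - apply (is_derive_comp exp (fun x => beta * h x)); [apply is_derive_exp |].
    apply is_derive_scal, h_derive.
  - unfold scal; simpl. unfold mult; simpl. ring.
Qed.

Lemma weight_continuous (x : R) : continuous W x.
Proof. exact (continuous_of_is_derive _ _ weight_derive x). Qed.

Lemma weight_bound (x : R) : 0 <= W x <= S / (1 + (b * x) ^ 2) ^ 5.
Proof.
  split; [apply Rlt_le, exp_pos |].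
  assert (Hp : 0 < 1 + (b * x) ^ 2) by (generalize (pow2_ge_0 (b * x)); lra).
  replace (S / (1 + (b * x) ^ 2) ^ 5) with (exp (beta * h 0 - 5 * ln (1 + (b * x) ^ 2))).
  - apply exp_le_compat. rewrite Rpow_mult_distr, scale_sq.
    generalize (ln_1p_bernoulli (c * beta / 5) (x ^ 2) scale_sq_ge_1 (pow2_ge_0 x)).
    generalize (h_upper x) beta_pos. nra.
  - rewrite <- (Rpower_pow 5 _ Hp). unfold Rpower, Rminus, Rdiv.
    rewrite exp_plus, exp_Ropp. replace (INR 5) with 5 by (simpl; lra). reflexivity.
Qed.

Lemma zeta_pos : 0 < zeta.
Proof. unfold zeta. generalize (exp_pos (- (5 * c' / c))). lra. Qed.

Lemma weight_mass : zeta * S / b <= integR W.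
Proof.
  assert (Hb := scale_ge_1). assert (HbX : 0 < / b) by (apply Rinv_0_lt_compat; lra).
  assert (Hb1 : / b <= 1) by (rewrite <- Rinv_1; apply Rinv_le_contravar; lra).
  assert (Hdom := weighted_dominated W S b Hb weight_bound (fun _ => 1) 1
                    ltac:(intros x; cbv beta; rewrite Rabs_R1, Rmult_1_l; apply one_le_pow_1p_sq)).
  apply integR_ge with (1 * S) b (/ b); [lra | apply weight_continuous | |].
  { intros x. generalize (Hdom x). now rewrite (Rmult_1_l (W x)). }
  assert (Hmon : forall x y, x <= y -> 0 <= RInt W 0 y - RInt W 0 x).
  { intros x y Hxy.
    generalize (primitive_increment_ge W 0 x y weight_continuous Hxy
                  (fun t _ => proj1 (weight_bound t))). lra. }
  assert (Hmid : S * exp (- (5 * c' / c)) * (/ b - - / b) <= RInt W 0 (/ b) - RInt W 0 (- / b)).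
  { apply primitive_increment_ge; [apply weight_continuous | lra |].
    intros t Ht. unfold S, W. rewrite <- exp_plus. apply exp_le_compat.
    assert (Ht1 : Rabs t <= / b) by (apply Rabs_le; lra).
    assert (Ht2 : t ^ 2 <= / (c * beta / 5)).
    { rewrite <- scale_sq, <- (pow2_abs t), <- pow_inv.
      apply pow_incr. split; [apply Rabs_pos | exact Ht1]. }
    assert (Hbeta := beta_pos).
    assert (Hl := h_lower t ltac:(lra)).
    assert (Hc' : 0 <= c').
    { generalize (h_lower 1 ltac:(rewrite Rabs_R1; lra)) (h_upper 1).
      assert (0 < ln (1 + 1 ^ 2)) by (rewrite <- ln_1; apply ln_increasing; lra). nra. }
    assert (beta * (c' * t ^ 2) <= 5 * c' / c).
    { replace (5 * c' / c) with (beta * (c' * / (c * beta / 5))) by (field; lra).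
      apply Rmult_le_compat_l; [lra |]. now apply Rmult_le_compat_l. }
    nra. }
  intros x y Hx Hy. generalize (Hmon x (- / b) Hx) (Hmon (/ b) y Hy).
  replace (zeta * S / b) with (S * exp (- (5 * c' / c)) * (/ b - - / b))
    by (unfold zeta; field; lra). lra.
Qed.

Lemma weight_mass_pos : 0 < integR W.
Proof.
  eapply Rlt_le_trans; [| exact weight_mass].
  apply Rdiv_lt_0_compat; [| generalize scale_ge_1; lra].
  apply Rmult_lt_0_compat; [apply zeta_pos | apply exp_pos].
Qed.

Let E : (R -> R) -> R := mean W.
Let comb4 := mean_comb4 W S b scale_ge_1 weight_continuous weight_bound weight_mass_pos.

(** Stein's identity for the weight [exp (beta * h)]. The exact identities below are its instances
    for [u] equal to [x], [x^3] and [x h]. *)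
Lemma mean_stein (u u1 v : R -> R) :
  poly_bounded 4 u -> (forall x, is_derive u x (u1 x)) ->
  poly_bounded 4 u1 -> poly_bounded 4 v -> (forall x, v x = u x * h1 x) ->
  E u1 = - (beta * E v).
Proof.
  intros Hu Hd Hu1 Hv Heq.
  assert (H := mean_by_parts W S b scale_ge_1 weight_continuous weight_bound
    beta h1 u u1 weight_derive Hu Hd (proj1 Hu1)
    (continuous_of_is_derive _ _ h1_derive)).
  rewrite (comb4 1 beta 0 0 (fun x => u1 x + beta * (u x * h1 x)) u1 v u1 u1) in H; auto.
  - unfold E. lra.
  - intros x. rewrite Heq. ring.
Qed.

(** [rho], [kap] and [tau] are what remains of [h], [x h'] and [x^2 h''] beyond their quadratic (for
    [h] also constant) parts; all three obey the same cubic-quartic bound. *)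
Let rho (x : R) : R := h x - h 0 + sigma / 2 * x ^ 2.
Let kap (x : R) : R := x * h1 x + sigma * x ^ 2.
Let tau (x : R) : R := x ^ 2 * h2 x + sigma * x ^ 2.

Ltac continuity_tac :=
  intros; unfold Rminus;
  repeat first [apply continuous_Rplus | apply continuous_Rmult
               | apply (continuous_of_is_derive _ _ h_derive)
               | apply (continuous_of_is_derive _ _ h1_derive)
               | apply h2_continuous | apply continuous_const | apply continuous_id
               | apply (@ex_derive_continuous R_AbsRing R_NormedModule); auto_derive; exact I].

Lemma rho_continuous (x : R) : continuous rho x.
Proof. unfold rho. continuity_tac. Qed.

Lemma kap_continuous (x : R) : continuous kap x.
Proof. unfold kap. continuity_tac. Qed.

Lemma tau_continuous (x : R) : continuous tau x.
Proof. unfold tau. continuity_tac. Qed.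

Definition remainder_like (g : R -> R) : Prop :=
  (forall x, continuous g x) /\
  forall x, Rabs (g x) <= c3 * Rabs x ^ 3 + M * Rabs x ^ 4.

Lemma remainder_poly_bounded (g : R -> R) : remainder_like g -> poly_bounded 2 g.
Proof.
  intros [Hc Hb]. apply poly_bounded_intro with c3 M 3%nat 4%nat; auto; lia.
Qed.

Let K : R := PI / zeta.
(** The remainder bound evaluated at the natural length [|x| = 1 / b]. *)
Let q : R := c3 / b ^ 3 + M / b ^ 4.

Lemma mean_remainder (g : R -> R) : remainder_like g -> Rabs (E g) <= K * q.
Proof.
  intros [Hc Hb].
  apply (mean_abs_le W S b scale_ge_1 weight_continuous weight_bound weight_mass_pos);
    auto using zeta_pos, weight_mass; lia.
Qed.

Lemma mean_sq_remainder (g : R -> R) : remainder_like g ->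
  Rabs (E (fun x => x ^ 2 * g x)) <= K * (q / b ^ 2).
Proof.
  intros [Hc Hb]. assert (Hb1 := scale_ge_1).
  replace (q / b ^ 2) with (c3 / b ^ 5 + M / b ^ 6) by (unfold q; field; lra).
  apply (mean_abs_le W S b scale_ge_1 weight_continuous weight_bound weight_mass_pos);
    auto using zeta_pos, weight_mass; try lia.
  - intros x. apply continuous_Rmult; [| apply Hc].
    apply (@ex_derive_continuous R_AbsRing R_NormedModule). auto_derive. exact I.
  - intros x. rewrite Rabs_mult, <- RPow_abs.
    replace (c3 * Rabs x ^ 5 + M * Rabs x ^ 6)
      with (Rabs x ^ 2 * (c3 * Rabs x ^ 3 + M * Rabs x ^ 4)) by ring.
    apply Rmult_le_compat_l; [apply pow_le, Rabs_pos | apply Hb].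
Qed.

(** By [(u + v)^2 <= 2 u^2 + 2 v^2]; the square of the quartic term is where the eighth moment
    enters. *)
Lemma mean_remainder_sq (g : R -> R) : remainder_like g ->
  Rabs (E (fun x => g x * g x)) <= K * (2 * q ^ 2).
Proof.
  intros [Hc Hb]. assert (Hb1 := scale_ge_1).
  apply Rle_trans with (K * (2 * c3 ^ 2 / b ^ 6 + 2 * M ^ 2 / b ^ 8)).
  - apply (mean_abs_le W S b scale_ge_1 weight_continuous weight_bound weight_mass_pos);
      auto using zeta_pos, weight_mass; try lia; try nra.
    + intros x. apply continuous_Rmult; apply Hc.
    + intros x. rewrite Rabs_mult.
      set (r := Rabs x). assert (Hr : 0 <= r) by apply Rabs_pos.
      apply Rle_trans with ((c3 * r ^ 3 + M * r ^ 4) * (c3 * r ^ 3 + M * r ^ 4)).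
      { apply Rmult_le_compat; auto using Rabs_pos; apply Hb. }
      generalize (pow2_ge_0 (c3 * r ^ 3 - M * r ^ 4)). nra.
  - apply Rmult_le_compat_l.
    { apply Rlt_le, Rdiv_lt_0_compat; [apply PI_RGT_0 | apply zeta_pos]. }
    replace (2 * c3 ^ 2 / b ^ 6) with (2 * (c3 / b ^ 3) ^ 2) by (field; lra).
    replace (2 * M ^ 2 / b ^ 8) with (2 * (M / b ^ 4) ^ 2) by (field; lra).
    assert (0 <= c3 / b ^ 3) by (apply Rdiv_le_0_compat; [lra | apply pow_lt; lra]).
    assert (0 <= M / b ^ 4) by (apply Rdiv_le_0_compat; [lra | apply pow_lt; lra]).
    unfold q. nra.
Qed.

Lemma rho_like : remainder_like rho.
Proof. split; [apply rho_continuous | exact h_expand]. Qed.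

Lemma kap_like : remainder_like kap.
Proof. split; [apply kap_continuous | exact h1_expand]. Qed.

Lemma tau_like : remainder_like tau.
Proof. split; [apply tau_continuous | exact h2_expand]. Qed.

Let m2 (x : R) : R := 1 * x ^ 2.
Let m4 (x : R) : R := 1 * x ^ 4.

Lemma m2_poly_bounded : poly_bounded 4 m2.
Proof. apply poly_bounded_monomial; lia. Qed.

Lemma m4_poly_bounded : poly_bounded 4 m4.
Proof. apply poly_bounded_monomial; lia. Qed.

Lemma one_poly_bounded : poly_bounded 4 (fun _ => 1).
Proof. apply poly_bounded_const. Qed.

Lemma sq_remainder_poly_bounded (g : R -> R) :
  remainder_like g -> poly_bounded 4 (fun x => x ^ 2 * g x).
Proof.
  intros Hg. apply (poly_bounded_le 3); [lia |].
  apply (poly_bounded_mult 1 2); [| now apply remainder_poly_bounded].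
  apply (poly_bounded_ext _ _ (fun x => 1 * x ^ 2)); [intros; ring |].
  apply poly_bounded_monomial; lia.
Qed.

Lemma k_poly_bounded : poly_bounded 2 (fun x => x * h1 x).
Proof.
  apply (poly_bounded_ext _ _ (fun x => 1 * kap x + (- sigma) * (1 * x ^ 2))).
  - intros x. unfold kap. ring.
  - apply poly_bounded_lin; [apply remainder_poly_bounded, kap_like |].
    apply poly_bounded_monomial; lia.
Qed.

Lemma h_poly_bounded : poly_bounded 2 h.
Proof.
  apply (poly_bounded_ext _ _
    (fun x => 1 * rho x + 1 * (h 0 * 1 + (- (sigma / 2)) * (1 * x ^ 2)))).
  - intros x. unfold rho. ring.
  - apply poly_bounded_lin; [apply remainder_poly_bounded, rho_like |].
    apply poly_bounded_lin; [apply poly_bounded_const |].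
    apply poly_bounded_monomial; lia.
Qed.

Lemma mean_k : E (fun x => x * h1 x) = - (1 / beta).
Proof.
  assert (Hbeta := beta_pos).
  assert (HS : E (fun _ => 1) = - (beta * E (fun x => x * h1 x))).
  { apply mean_stein with (fun x => 1 * x ^ 1).
    - apply poly_bounded_monomial; lia.
    - intros x. auto_derive; [exact I | ring].
    - apply one_poly_bounded.
    - apply (poly_bounded_le 2); [lia | apply k_poly_bounded].
    - intros x. ring. }
  unfold E in HS at 1. rewrite (mean_1 W weight_mass_pos) in HS.
  apply Rmult_eq_reg_l with beta; [| lra].
  replace (beta * - (1 / beta)) with (- (1)) by (field; lra). lra.
Qed.

Lemma second_moment : sigma * E m2 = 1 / beta + E kap.
Proof.
  generalize mean_k. unfold E.
  rewrite (comb4 1 (- sigma) 0 0 (fun x => x * h1 x) kap m2 m2 m2);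
    auto using m2_poly_bounded.
  - lra.
  - apply (poly_bounded_le 2); [lia | apply remainder_poly_bounded, kap_like].
  - intros x. unfold kap, m2. ring.
Qed.

Lemma fourth_moment : sigma * E m4 = 3 * E m2 / beta + E (fun x => x ^ 2 * kap x).
Proof.
  assert (Hbeta := beta_pos).
  assert (Hk := sq_remainder_poly_bounded _ kap_like).
  assert (Heq : forall x, x ^ 3 * h1 x
            = 1 * (x ^ 2 * kap x) + (- sigma) * m4 x + 0 * m4 x + 0 * m4 x)
    by (intros x; unfold kap, m4; ring).
  assert (HS : E (fun x => 3 * x ^ 2) = - (beta * E (fun x => x ^ 3 * h1 x))).
  { apply mean_stein with (fun x => 1 * x ^ 3).
    - apply poly_bounded_monomial; lia.
    - intros x. auto_derive; [exact I | ring].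
    - apply poly_bounded_monomial; lia.
    - apply (poly_bounded_ext _ _ (fun x => 1 * (x ^ 2 * kap x) + (- sigma) * m4 x)).
      + intros x. rewrite Heq. ring.
      + apply poly_bounded_lin; [exact Hk | apply m4_poly_bounded].
    - intros x. ring. }
  unfold E in HS.
  rewrite (comb4 1 (- sigma) 0 0 (fun x => x ^ 3 * h1 x) (fun x => x ^ 2 * kap x) m4 m4 m4) in HS;
    auto using m4_poly_bounded.
  rewrite (comb4 3 0 0 0 (fun x => 3 * x ^ 2) m2 m2 m2 m2) in HS;
    auto using m2_poly_bounded; [| intros x; unfold m2; ring].
  fold E in HS. apply Rmult_eq_reg_l with beta; [| lra].
  replace (beta * (3 * E m2 / beta + E (fun x => x ^ 2 * kap x)))
    with (3 * E m2 + beta * E (fun x => x ^ 2 * kap x)) by (field; lra).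
  lra.
Qed.

(** Stein's identity with [u = x h] gives [E h + E k = - beta E[h k]]; inserting [E k = - 1 / beta]
    makes [E h] drop out of the covariance. *)
Lemma covariance_h_k :
  E (fun x => h x * (x * h1 x)) - E h * E (fun x => x * h1 x) = 1 / beta ^ 2.
Proof.
  assert (Hbeta := beta_pos).
  assert (Hh4 : poly_bounded 4 h) by (apply (poly_bounded_le 2); [lia | apply h_poly_bounded]).
  assert (Hk4 : poly_bounded 4 (fun x => x * h1 x))
    by (apply (poly_bounded_le 2); [lia | apply k_poly_bounded]).
  assert (HS : E (fun x => 1 * h x + 1 * (x * h1 x))
               = - (beta * E (fun x => h x * (x * h1 x)))).
  { apply mean_stein with (fun x => (1 * x ^ 1) * h x).
    - apply (poly_bounded_le 3); [lia |]. apply (poly_bounded_mult 1 2).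
      + apply poly_bounded_monomial; lia.
      + apply h_poly_bounded.
    - intros x. evar_last.
      + apply (is_derive_mult (fun x => 1 * x ^ 1) h); [| apply h_derive |].
        * auto_derive; [exact I | reflexivity].
        * intros; apply Rmult_comm.
      + unfold plus, mult; simpl. ring.
    - now apply poly_bounded_lin.
    - apply (poly_bounded_mult 2 2); [apply h_poly_bounded | apply k_poly_bounded].
    - intros x. ring. }
  unfold E in HS at 1.
  rewrite (mean_lin W S b scale_ge_1 weight_continuous weight_bound weight_mass_pos) in HS
    by assumption.
  fold E in HS. rewrite mean_k in HS. rewrite mean_k.
  replace (E (fun x => h x * (x * h1 x))) with (- (1 * E h + 1 * - (1 / beta)) / beta).
  - field. lra.
  - rewrite HS. field. lra.
Qed.

Lemma variance_h :
  E (fun x => h x * h x) - E h * E h =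
  sigma ^ 2 / 4 * E m4 - sigma * E (fun x => x ^ 2 * rho x) + E (fun x => rho x * rho x)
  - (E rho - sigma / 2 * E m2) ^ 2.
Proof.
  assert (Hr := sq_remainder_poly_bounded _ rho_like).
  assert (Hr4 : poly_bounded 4 rho)
    by (apply (poly_bounded_le 2); [lia | apply remainder_poly_bounded, rho_like]).
  assert (Hrr : poly_bounded 4 (fun x => rho x * rho x))
    by (apply (poly_bounded_mult 2 2); apply remainder_poly_bounded, rho_like).
  assert (Hh4 : poly_bounded 4 h) by (apply (poly_bounded_le 2); [lia | apply h_poly_bounded]).
  (* [w2] is [(h - h 0)^2] expanded through [rho]; then [h^2 = w2 + 2 (h 0) h - (h 0)^2], and the
     shift by [h 0] disappears from the variance. *)
  set (w2 := fun x => sigma ^ 2 / 4 * m4 x + (- sigma) * (x ^ 2 * rho x)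
                      + 1 * (rho x * rho x) + 0 * m4 x).
  assert (Hw2 : poly_bounded 4 w2).
  { apply (poly_bounded_ext _ _ (fun x => 1 * (sigma ^ 2 / 4 * m4 x + (- sigma) * (x ^ 2 * rho x))
      + 1 * (rho x * rho x))).
    - intros x. unfold w2. ring.
    - apply poly_bounded_lin; [| exact Hrr]. apply poly_bounded_lin; [| exact Hr].
      apply m4_poly_bounded. }
  assert (Ew2 : E w2 = sigma ^ 2 / 4 * E m4 + (- sigma) * E (fun x => x ^ 2 * rho x)
                       + 1 * E (fun x => rho x * rho x) + 0 * E m4).
  { apply comb4; auto using m4_poly_bounded. }
  assert (E1 : E (fun _ => 1) = 1) by exact (mean_1 W weight_mass_pos).
  assert (Eh : E h = h 0 * E (fun _ => 1) + (- (sigma / 2)) * E m2 + 1 * E rho + 0 * E rho).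
  { apply comb4; auto using m2_poly_bounded, one_poly_bounded.
    intros x. unfold rho, m2. field. }
  assert (Ehh : E (fun x => h x * h x)
            = 1 * E w2 + (2 * h 0) * E h + (- h 0 ^ 2) * E (fun _ => 1) + 0 * E h).
  { apply comb4; auto using one_poly_bounded.
    intros x. unfold w2, rho, m4. field. }
  rewrite Ehh, Ew2, Eh, E1. field.
Qed.

(** [r] and [k] share the quadratic part [- sigma x^2], so only remainders are left. *)
Lemma mean_r_minus_k : E (fun x => x ^ 2 * h2 x - x * h1 x) = E tau - E kap.
Proof.
  assert (Hk4 : poly_bounded 4 kap)
    by (apply (poly_bounded_le 2); [lia | apply remainder_poly_bounded, kap_like]).
  assert (Ht4 : poly_bounded 4 tau)
    by (apply (poly_bounded_le 2); [lia | apply remainder_poly_bounded, tau_like]).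
  unfold E. rewrite (comb4 1 (- 1) 0 0 (fun x => x ^ 2 * h2 x - x * h1 x) tau kap kap kap); auto.
  - ring.
  - intros x. unfold tau, kap. ring.
Qed.

Lemma expansion_bound :
  Rabs ((E (fun x => h x * (x * h1 x)) - E h * E (fun x => x * h1 x)) / 2
        - (E (fun x => h x * h x) - E h * E h)
        + E (fun x => x ^ 2 * h2 x - x * h1 x) / (4 * beta))
  <= K * (3 * (c / 5) + 2 * sigma + 2 * (c3 + M) + 3 * K * (c3 + M))
     * (c3 / b ^ 5 + M / b ^ 6).
Proof.
  assert (Hbeta := beta_pos). assert (Hb := scale_ge_1). assert (Hb2 := scale_sq).
  rewrite covariance_h_k, variance_h, mean_r_minus_k.
  assert (H2 := second_moment). assert (H4 := fourth_moment).
  set (s := 1 / beta) in *.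
  replace (1 / beta ^ 2) with (s ^ 2) by (unfold s; field; lra).
  replace ((E tau - E kap) / (4 * beta)) with (s * (E tau - E kap) / 4)
    by (unfold s; field; lra).
  replace (3 * E m2 / beta) with (3 * E m2 * s) in H4 by (unfold s; field; lra).
  replace (sigma ^ 2 / 4 * E m4) with (sigma * (sigma * E m4) / 4) by field.
  rewrite H4.
  replace (sigma / 2 * E m2) with (sigma * E m2 / 2) by field.
  replace (sigma * (3 * E m2 * s + E (fun x => x ^ 2 * kap x)) / 4) with
    (3 * (sigma * E m2) * s / 4 + sigma * E (fun x => x ^ 2 * kap x) / 4) by field.
  rewrite H2.
  assert (Hbi : forall n, 0 < b ^ n) by (intros n; apply pow_lt; lra).
  replace (c3 / b ^ 5 + M / b ^ 6) with (q * / b ^ 2)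
    by (unfold q; field; lra).
  (* The pure [s ^ 2] terms cancel here: 1/2 from the covariance, -3/4 from the fourth moment, 1/4
     from the squared mean. *)
  match goal with |- Rabs ?X <= _ => replace X with
    (- (s * E kap) / 2 - s * E rho + s * E tau / 4
     - sigma * E (fun x => x ^ 2 * kap x) / 4 + sigma * E (fun x => x ^ 2 * rho x)
     - E (fun x => rho x * rho x)
     + E kap * E kap / 4 - E kap * E rho + E rho * E rho) by field end.
  apply error_terms_bound; try lra.
  - apply Rlt_le, Rdiv_lt_0_compat; [apply PI_RGT_0 | apply zeta_pos].
  - unfold q. apply Rplus_le_le_0_compat; apply Rdiv_le_0_compat; auto.
  - apply Rlt_le, Rinv_0_lt_compat; auto.
  - rewrite Hb2. unfold s. field. lra.
  - unfold q. rewrite Rmult_plus_distr_r.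
    assert (Hle : forall n m, (n <= m)%nat -> / b ^ m <= / b ^ n).
    { intros n m Hnm. apply Rinv_le_contravar; [auto |]. now apply Rle_pow. }
    apply Rplus_le_compat; apply Rmult_le_compat_l; auto.
  - apply mean_remainder, kap_like.
  - apply (mean_sq_remainder kap kap_like).
  - apply (mean_sq_remainder rho rho_like).
  - apply (mean_remainder_sq rho rho_like).
  - apply mean_remainder, rho_like.
  - apply mean_remainder, tau_like.
Qed.

End Expansion.

(** * Derivatives of the log-density *)

Lemma Derive_eq (g g1 : R -> R) : (forall x, is_derive g x (g1 x)) -> Derive g = g1.
Proof.
  intros H. apply functional_extensionality. intros x. now apply is_derive_unique.
Qed.

(** The quotients [a n = f^(n) / f] satisfy [(a n)' = a (n + 1) - a n * a 1], and [(ln f)' = a 1];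
    so all further derivatives of [ln f] are polynomials in these quotients. *)
Lemma log_derivatives (f : R -> R) : (forall x, 0 < f x) -> C4 f ->
  exists h1 h2 h3 h4 : R -> R,
    (forall x, is_derive (hfun f) x (h1 x)) /\ (forall x, is_derive h1 x (h2 x)) /\
    (forall x, is_derive h2 x (h3 x)) /\ (forall x, is_derive h3 x (h4 x)).
Proof.
  intros Hf [HC4 _].
  set (a := fun n x => Derive_n f n x / f x).
  assert (Hf1 : forall x, is_derive f x (Derive_n f 1 x)).
  { intros x. apply Derive_correct. apply (HC4 1%nat x). lia. }
  assert (Ha : forall n x, (n <= 3)%nat -> is_derive (a n) x (a (S n) x - a n x * a 1%nat x)).
  { intros n x Hn. unfold a. evar_last.
    - apply is_derive_div; [| apply Hf1 | generalize (Hf x); lra].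
      apply Derive_correct. apply (HC4 (S n) x). lia.
    - cbn [Derive_n]. generalize (Hf x). intros. field. lra. }
  assert (H0 : forall x, is_derive (hfun f) x (a 1%nat x)).
  { intros x. unfold hfun. evar_last.
    - apply (is_derive_comp ln f); [apply is_derive_ln, Hf | apply Hf1].
    - unfold scal; simpl. unfold mult; simpl. unfold a. simpl. unfold Rdiv. ring. }
  (* Only the recurrences matter from here on; abstracting the quotients leaves a polynomial
     differentiation. *)
  generalize (fun x => Ha 1%nat x ltac:(lia)) (fun x => Ha 2%nat x ltac:(lia))
    (fun x => Ha 3%nat x ltac:(lia)).
  revert H0. generalize (a 1%nat) (a 2%nat) (a 3%nat) (a 4%nat).
  clear. intros a1 a2 a3 a4 H0 H1 H2 H3.
  exists a1, (fun x => a2 x - a1 x * a1 x),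
    (fun x => (a3 x - a2 x * a1 x) - 2 * a1 x * (a2 x - a1 x * a1 x)),
    (fun x => (a4 x - a3 x * a1 x)
       - ((a3 x - a2 x * a1 x) * a1 x + a2 x * (a2 x - a1 x * a1 x))
       - 2 * ((a2 x - a1 x * a1 x) * (a2 x - a1 x * a1 x)
              + a1 x * ((a3 x - a2 x * a1 x) - 2 * a1 x * (a2 x - a1 x * a1 x)))).
  assert (E1 : forall x, Derive (fun y => a1 y) x = _)
    by exact (fun x => is_derive_unique _ _ _ (H1 x)).
  assert (E2 : forall x, Derive (fun y => a2 y) x = _)
    by exact (fun x => is_derive_unique _ _ _ (H2 x)).
  assert (E3 : forall x, Derive (fun y => a3 y) x = _)
    by exact (fun x => is_derive_unique _ _ _ (H3 x)).
  refine (conj H0 (conj _ (conj _ _))); intros x;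
    (auto_derive;
     [repeat split; eexists; first [apply H1 | apply H2 | apply H3] |
      rewrite ?E1, ?E2, ?E3; ring]).
Qed.

(** The mean value theorem forgoes the factor [1 / (n + 1)] of integration but keeps the constant
    [C], so a single [M] serves all the Taylor bounds. *)
Lemma power_bound_primitive (g g1 : R -> R) (C : R) (n : nat) :
  (forall x, is_derive g x (g1 x)) -> g 0 = 0 ->
  (forall x, Rabs (g1 x) <= C * Rabs x ^ n) ->
  forall x, Rabs (g x) <= C * Rabs x ^ (S n).
Proof.
  intros HD H0 Hb x.
  assert (HC : 0 <= C).
  { generalize (Hb 1) (Rabs_pos (g1 1)). rewrite Rabs_R1, pow1. lra. }
  destruct (MVT_gen g 0 x g1 (fun t _ => HD t)) as [t [Ht Heq]].
  { intros t _. apply derivable_continuous_pt. eexists. apply is_derive_Reals, HD. }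
  rewrite H0, !Rminus_0_r in Heq. rewrite Heq, Rabs_mult.
  assert (Htx : Rabs t <= Rabs x).
  { revert Ht. unfold Rmin, Rmax. destruct (Rle_dec 0 x); intros Ht.
    - rewrite !Rabs_pos_eq; lra.
    - rewrite !Rabs_left1; lra. }
  replace (C * Rabs x ^ S n) with (C * Rabs x ^ n * Rabs x) by (simpl; ring).
  apply Rmult_le_compat_r; [apply Rabs_pos |].
  eapply Rle_trans; [apply Hb |]. apply Rmult_le_compat_l; [exact HC |].
  apply pow_incr. split; [apply Rabs_pos | exact Htx].
Qed.

(** * Taylor remainders of the log-density at its mode *)

Section Taylor.
Variables (h h1 h2 h3 h4 : R -> R) (sigma M : R).
Hypothesis D0 : forall x, is_derive h x (h1 x).
Hypothesis D1 : forall x, is_derive h1 x (h2 x).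
Hypothesis D2 : forall x, is_derive h2 x (h3 x).
Hypothesis D3 : forall x, is_derive h3 x (h4 x).
Hypothesis h4_bound : forall x, Rabs (h4 x) <= M.
Hypothesis h1_0 : h1 0 = 0.
Hypothesis h2_0 : h2 0 = - sigma.

Ltac taylor_derive H :=
  let x := fresh "x" in
  intros x; auto_derive; [repeat split; eexists; apply H |
    match type of (H x) with is_derive ?g _ ?l =>
      replace (Derive (fun y => g y) x) with l by (symmetry; apply is_derive_unique, H) end;
    field].

Lemma taylor_h3 (x : R) : Rabs (h3 x - h3 0) <= M * Rabs x ^ 1.
Proof.
  apply (power_bound_primitive (fun x => h3 x - h3 0) h4); [| ring |].
  - taylor_derive D3.
  - intros y. simpl. rewrite Rmult_1_r. apply h4_bound.
Qed.

Lemma taylor_h2 (x : R) : Rabs (h2 x + sigma - h3 0 * x) <= M * Rabs x ^ 2.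
Proof.
  apply (power_bound_primitive (fun x => h2 x + sigma - h3 0 * x) (fun x => h3 x - h3 0)).
  - taylor_derive D2.
  - rewrite h2_0. ring.
  - apply taylor_h3.
Qed.

Lemma taylor_h1 (x : R) : Rabs (h1 x + sigma * x - h3 0 / 2 * x ^ 2) <= M * Rabs x ^ 3.
Proof.
  apply (power_bound_primitive (fun x => h1 x + sigma * x - h3 0 / 2 * x ^ 2)
           (fun x => h2 x + sigma - h3 0 * x)).
  - taylor_derive D1.
  - rewrite h1_0. ring.
  - apply taylor_h2.
Qed.

Lemma taylor_h (x : R) :
  Rabs (h x - h 0 + sigma / 2 * x ^ 2 - h3 0 / 6 * x ^ 3) <= M * Rabs x ^ 4.
Proof.
  apply (power_bound_primitive (fun x => h x - h 0 + sigma / 2 * x ^ 2 - h3 0 / 6 * x ^ 3)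
           (fun x => h1 x + sigma * x - h3 0 / 2 * x ^ 2)).
  - taylor_derive D0.
  - ring.
  - apply taylor_h1.
Qed.

(** Moves the cubic Taylor term into the error; [d] is 1/6, 1/2 and 1 for [h], [x h'] and
    [x^2 h'']. *)
Lemma cubic_remainder (y z x d : R) : 0 <= d <= 1 ->
  Rabs (y - h3 0 * d * x ^ 3) <= M * Rabs x ^ 4 -> z = y ->
  Rabs z <= Rabs (h3 0) * Rabs x ^ 3 + M * Rabs x ^ 4.
Proof.
  intros Hd Hb ->.
  replace y with (h3 0 * d * x ^ 3 + (y - h3 0 * d * x ^ 3)) by ring.
  eapply Rle_trans; [apply Rabs_triang |]. apply Rplus_le_compat; [| exact Hb].
  rewrite !Rabs_mult, <- RPow_abs, (Rabs_pos_eq d) by lra.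
  apply Rmult_le_compat_r; [apply pow_le, Rabs_pos |].
  generalize (Rabs_pos (h3 0)). nra.
Qed.

Lemma expand_h (x : R) :
  Rabs (h x - h 0 + sigma / 2 * x ^ 2) <= Rabs (h3 0) * Rabs x ^ 3 + M * Rabs x ^ 4.
Proof.
  apply cubic_remainder with (y := h x - h 0 + sigma / 2 * x ^ 2) (d := / 6); [lra | | ring].
  apply taylor_h.
Qed.

Lemma expand_h1 (x : R) :
  Rabs (x * h1 x + sigma * x ^ 2) <= Rabs (h3 0) * Rabs x ^ 3 + M * Rabs x ^ 4.
Proof.
  apply cubic_remainder with (y := x * h1 x + sigma * x ^ 2) (d := / 2); [lra | | ring].
  replace (x * h1 x + sigma * x ^ 2 - h3 0 * / 2 * x ^ 3)
    with (x * (h1 x + sigma * x - h3 0 / 2 * x ^ 2)) by field.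
  replace (M * Rabs x ^ 4) with (Rabs x * (M * Rabs x ^ 3)) by ring.
  rewrite Rabs_mult. apply Rmult_le_compat_l; [apply Rabs_pos | apply taylor_h1].
Qed.

Lemma expand_h2 (x : R) :
  Rabs (x ^ 2 * h2 x + sigma * x ^ 2) <= Rabs (h3 0) * Rabs x ^ 3 + M * Rabs x ^ 4.
Proof.
  apply cubic_remainder with (y := x ^ 2 * h2 x + sigma * x ^ 2) (d := 1); [lra | | ring].
  replace (x ^ 2 * h2 x + sigma * x ^ 2 - h3 0 * 1 * x ^ 3)
    with (x ^ 2 * (h2 x + sigma - h3 0 * x)) by field.
  replace (M * Rabs x ^ 4) with (Rabs x ^ 2 * (M * Rabs x ^ 2)) by ring.
  rewrite Rabs_mult, <- RPow_abs.
  apply Rmult_le_compat_l; [apply pow_le, Rabs_pos | apply taylor_h2].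
Qed.

(** Subtracting the expansions at [x] and [- x] leaves [t / 3 * x ^ 3], bounded by [2 * M * x ^ 4],
    which is impossible for small [x] unless [t = 0]. *)
Lemma third_derivative_even : 0 < M -> (forall x, h (- x) = h x) -> h3 0 = 0.
Proof.
  intros HM Heven. set (t := h3 0).
  destruct (Req_dec t 0) as [Ht | Ht]; [exact Ht | exfalso].
  assert (Habs : 0 < Rabs t) by now apply Rabs_pos_lt.
  (* With this choice [2 * M * x = |t| / 6], strictly below [|t| / 3]. *)
  set (x := Rabs t / (12 * M)).
  assert (Hx : 0 < x) by (apply Rdiv_lt_0_compat; lra).
  assert (P1 := taylor_h x). assert (P2 := taylor_h (- x)). fold t in P1, P2.
  rewrite Heven in P2. rewrite Rabs_Ropp in P2. rewrite (Rabs_pos_eq x) in P1, P2 by lra.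
  assert (P3 : Rabs (t / 3 * x ^ 3) <= 2 * (M * x ^ 4)).
  { replace (t / 3 * x ^ 3) with
      ((h x - h 0 + sigma / 2 * (- x) ^ 2 - t / 6 * (- x) ^ 3)
       - (h x - h 0 + sigma / 2 * x ^ 2 - t / 6 * x ^ 3)) by field.
    unfold Rminus at 1. eapply Rle_trans; [apply Rabs_triang |]. rewrite Rabs_Ropp. lra. }
  assert (Hx3 : 0 < x ^ 3) by now apply pow_lt.
  rewrite Rabs_mult, (Rabs_pos_eq (x ^ 3)) in P3 by lra.
  unfold Rdiv in P3. rewrite Rabs_mult, (Rabs_pos_eq (/ 3)) in P3 by lra.
  assert (HMx : M * x = Rabs t / 12) by (unfold x; field; lra).
  replace (2 * (M * x ^ 4)) with (2 * (M * x) * x ^ 3) in P3 by ring.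
  rewrite HMx in P3. nra.
Qed.

(** Half of [sigma / 2 * x ^ 2] absorbs the remainder once [Q * |x| <= sigma / 4]. This starts the
    logarithmic growth bound near 0. *)
Lemma quadratic_lower : 0 < M -> 0 < sigma -> exists delta, 0 < delta /\
  forall x, Rabs x <= delta -> sigma / 4 * x ^ 2 <= h 0 - h x.
Proof.
  intros HM Hs. set (Q := Rabs (h3 0) + M).
  assert (HQ : 0 < Q) by (generalize (Rabs_pos (h3 0)); unfold Q; lra).
  exists (Rmin 1 (sigma / (4 * Q))). split.
  { apply Rmin_glb_lt; [lra | apply Rdiv_lt_0_compat; lra]. }
  intros x Hx.
  assert (Hx1 : Rabs x <= 1) by (eapply Rle_trans; [exact Hx | apply Rmin_l]).
  assert (Hx2 : Q * Rabs x <= sigma / 4).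
  { replace (sigma / 4) with (Q * (sigma / (4 * Q))) by (field; lra).
    apply Rmult_le_compat_l; [lra |]. eapply Rle_trans; [exact Hx | apply Rmin_r]. }
  generalize (proj1 (Rabs_le_between _ _) (expand_h x)).
  rewrite <- (pow2_abs x). set (r := Rabs x) in *.
  assert (Hr : 0 <= r) by apply Rabs_pos.
  assert (H34 : Rabs (h3 0) * r ^ 3 + M * r ^ 4 <= Q * r * r ^ 2).
  { assert (r ^ 4 <= r ^ 3) by (simpl; assert (0 <= r * (r * r)) by nra; nra). unfold Q. nra. }
  assert (Q * r * r ^ 2 <= sigma / 4 * r ^ 2) by (apply Rmult_le_compat_r; [nra | exact Hx2]).
  lra.
Qed.

Lemma quadratic_upper (x : R) : 0 < M -> Rabs x <= 1 ->
  h 0 - h x <= (sigma / 2 + (Rabs (h3 0) + M)) * x ^ 2.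
Proof.
  intros HM Hx. generalize (proj1 (Rabs_le_between _ _) (expand_h x)).
  rewrite <- (pow2_abs x). set (r := Rabs x) in *.
  assert (Hr : 0 <= r) by apply Rabs_pos. assert (H3 := Rabs_pos (h3 0)).
  assert (r ^ 3 <= r ^ 2) by (simpl; nra).
  assert (r ^ 4 <= r ^ 2) by (simpl; assert (r * r <= 1) by nra; nra).
  nra.
Qed.

End Taylor.

(** * Global decay of the density and proof of the theorem *)

Lemma unimodal0_log_growth (f : R -> R) (c0 delta : R) :
  (forall x, 0 < f x) -> unimodal0 f -> reg_var (fun x => - ln (f x)) ->
  0 < c0 -> 0 < delta ->
  (forall x, Rabs x <= delta -> c0 * x ^ 2 <= hfun f 0 - hfun f x) ->
  exists c, 0 < c /\ forall x, c * ln (1 + x ^ 2) <= hfun f 0 - hfun f x.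
Proof.
  intros Hf [HunimL HunimR] [alpha [Halpha Hreg]] Hc0 Hdelta Hnear.
  destruct (Hreg 2 ltac:(lra)) as [Hp Hm].
  (* Regular variation enters at the factor 2, where the limiting ratio exceeds 1 because [alpha] is
     positive. *)
  assert (HL : 1 < Rpower 2 alpha).
  { rewrite <- (Rpower_O 2) by lra. apply Rpower_lt; lra. }
  destruct (log_growth (fun x => - hfun f x) (Rpower 2 alpha) c0 delta)
    as [c1 [Hc1 Hb1]]; try assumption.
  { intros x y Hxy. apply Ropp_le_contravar, ln_le; [apply Hf | now apply HunimR]. }
  { intros x Hx. generalize (Hnear x ltac:(rewrite Rabs_pos_eq; lra)). lra. }
  (* The left half-line is the right half-line of the reflected function; its limit at minus
     infinity is transported by [t -> - t]. *)
  destruct (log_growth (fun x => - hfun f (- x)) (Rpower 2 alpha) c0 delta)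
    as [c2 [Hc2 Hb2]]; try assumption.
  { intros x y Hxy. apply Ropp_le_contravar, ln_le; [apply Hf |].
    apply HunimL. lra. }
  { apply is_lim_ext with (fun t => (fun s => - ln (f (s * 2)) / - ln (f s)) (- t)).
    - intros t. unfold hfun. now rewrite Ropp_mult_distr_l.
    - exact (filterlim_comp _ _ _ Ropp (fun s => - ln (f (s * 2)) / - ln (f s)) _ _ _
               (filterlim_Rbar_opp p_infty) Hm). }
  { intros x Hx. rewrite Ropp_0.
    generalize (Hnear (- x) ltac:(rewrite Rabs_Ropp, Rabs_pos_eq; lra)).
    replace ((- x) ^ 2) with (x ^ 2) by ring. lra. }
  exists (Rmin c1 c2). split; [now apply Rmin_glb_lt |]. intros x.
  assert (Hln : 0 <= ln (1 + x ^ 2)).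
  { rewrite <- ln_1. apply ln_le; [lra | generalize (pow2_ge_0 x); lra]. }
  destruct (Rle_dec 0 x) as [Hx | Hx].
  - generalize (Hb1 x Hx) (Rmin_l c1 c2). nra.
  - generalize (Hb2 (- x) ltac:(lra)) (Rmin_r c1 c2).
    rewrite Ropp_involutive, Ropp_0. replace ((- x) ^ 2) with (x ^ 2) by ring. nra.
Qed.

(** Converts [b^-n] into a power of beta; [n = 5] admits [k] up to 5/2 and [n = 6] admits [k] up to
    3. *)
Lemma inv_sqrt_pow_le (a beta k : R) (n : nat) :
  0 < a -> 1 <= beta -> k <= INR n / 2 ->
  / sqrt (a * beta) ^ n <= Rpower a (- (INR n / 2)) * Rpower beta (- k).
Proof.
  intros Ha Hbeta Hk.
  assert (Hab : 0 < a * beta) by (apply Rmult_lt_0_compat; lra).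
  rewrite <- (Rpower_pow n) by now apply sqrt_lt_R0.
  rewrite <- Rpower_sqrt by exact Hab.
  rewrite Rpower_mult, <- Rpower_Ropp.
  replace (- (/ 2 * INR n)) with (- (INR n / 2)) by field.
  rewrite <- Rpower_mult_distr by lra.
  apply Rmult_le_compat_l; [apply Rlt_le, exp_pos |].
  destruct Hbeta as [Hb | <-].
  - apply Rle_Rpower; lra.
  - unfold Rpower. rewrite ln_1, !Rmult_0_r. apply Rle_refl.
Qed.

Theorem theorem2 (f : R -> R) (M gamma : R) :
  (forall x, 0 < f x) ->
  C4 f ->
  unimodal0 f ->
  reg_var (fun x => - ln (f x)) ->
  0 < M ->
  (forall z, Rabs (Derive_n (hfun f) 4 z) < M) ->
  Derive_n (hfun f) 2 0 < 0 ->
  0 < gamma ->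
  bigO_pow (fun beta => VargY2 f beta - 2) gamma ->
  forall k : R,
    (symmetric0 f -> k = Rmin (2 + gamma) 3) ->
    (~ symmetric0 f -> k = Rmin (2 + gamma) (5 / 2)) ->
    bigO_pow (fun beta => Vfun f beta / 2 - Ifun f beta + Rfun f beta / (4 * beta)) k /\
    (exists C beta0, forall beta lhat, beta0 <= beta -> is_opt_ell f beta lhat ->
       / lhat <= C * Rpower beta (- (k / 2))).
Proof.
  intros Hf HC4 Hunim Hreg HM H4 H2 _ _ k Hsym Hnsym.
  destruct (log_derivatives f Hf HC4) as [h1 [h2 [h3 [h4 [D0 [D1 [D2 D3]]]]]]].
  assert (E1 : Derive (hfun f) = h1) by now apply Derive_eq.
  assert (E2 : Derive_n (hfun f) 2 = h2).
  { change (Derive (fun x => Derive (hfun f) x) = h2).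
    rewrite E1. now apply Derive_eq. }
  assert (E4 : Derive_n (hfun f) 4 = h4).
  { change (Derive (Derive (Derive_n (hfun f) 2)) = h4).
    rewrite E2, (Derive_eq h2 h3 D2). now apply Derive_eq. }
  rewrite E4 in H4. rewrite E2 in H2.
  set (sigma := - h2 0) in *.
  assert (Hsigma : 0 < sigma) by (unfold sigma; lra).
  assert (h2_0 : h2 0 = - sigma) by (unfold sigma; ring).
  assert (h1_0 : h1 0 = 0).
  { apply (deriv_maximum (hfun f) (- 1) 1 0
      (exist _ (h1 0) (proj1 (is_derive_Reals _ _ _) (D0 0)))); try lra.
    intros x _ _. apply ln_le; [apply Hf |]. destruct Hunim as [HL HR].
    destruct (Rle_dec 0 x); [apply HR | apply HL]; lra. }
  assert (h4_bound : forall x, Rabs (h4 x) <= M) by (intros x; apply Rlt_le, H4).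
  assert (X0 := expand_h _ _ _ _ _ sigma M D0 D1 D2 D3 h4_bound h1_0 h2_0).
  assert (X1 := expand_h1 _ _ _ _ sigma M D1 D2 D3 h4_bound h1_0 h2_0).
  assert (X2 := expand_h2 _ _ _ sigma M D2 D3 h4_bound h2_0).
  destruct (quadratic_lower _ _ _ _ _ sigma M D0 D1 D2 D3 h4_bound h1_0 h2_0 HM Hsigma)
    as [delta [Hdelta Hlow]].
  assert (Hup := fun x => quadratic_upper _ _ _ _ _ sigma M D0 D1 D2 D3 h4_bound h1_0 h2_0 x HM).
  destruct (unimodal0_log_growth f (sigma / 4) delta Hf Hunim Hreg ltac:(lra) Hdelta Hlow)
    as [c [Hc Hgrow]].
  set (c3 := Rabs (h3 0)) in *. set (c' := sigma / 2 + (c3 + M)) in *.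
  assert (Hc3 : 0 <= c3) by apply Rabs_pos.
  (* The term in [b^-5] carries the factor [c3]: it vanishes in the symmetric case, and otherwise
     [k <= 5 / 2] tolerates it. *)
  assert (Hk : c3 = 0 \/ k <= 5 / 2).
  { destruct (classic (symmetric0 f)) as [Hs | Hs].
    - left. unfold c3.
      rewrite (third_derivative_even _ _ _ _ _ sigma M D0 D1 D2 D3 h4_bound h1_0 h2_0 HM).
      + apply Rabs_R0.
      + intros x. unfold hfun. now rewrite Hs.
    - right. rewrite (Hnsym Hs). apply Rmin_r. }
  assert (Hk3 : k <= 3).
  { destruct (classic (symmetric0 f)) as [Hs | Hs].
    - rewrite (Hsym Hs). apply Rmin_r.
    - rewrite (Hnsym Hs). eapply Rle_trans; [apply Rmin_r | lra]. }
  set (K := PI / (2 * exp (- (5 * c' / c)))).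
  set (C1 := K * (3 * (c / 5) + 2 * sigma + 2 * (c3 + M) + 3 * K * (c3 + M))).
  assert (HK : 0 < K).
  { apply Rdiv_lt_0_compat; [apply PI_RGT_0 |]. generalize (exp_pos (- (5 * c' / c))). lra. }
  assert (HC1 : 0 < C1).
  { apply Rmult_lt_0_compat; [exact HK |].
    assert (0 <= K * (c3 + M)) by (apply Rmult_le_pos; lra). lra. }
  set (C := C1 * (c3 * Rpower (c / 5) (- (INR 5 / 2)) + M * Rpower (c / 5) (- (INR 6 / 2)))).
  (* The threshold [5 / c] ensures [b >= 1]; the threshold 1 makes powers of beta monotone in the
     exponent. *)
  assert (Hmain : forall beta, Rmax 1 (5 / c) <= beta ->
    Rabs (Vfun f beta / 2 - Ifun f beta + Rfun f beta / (4 * beta)) <= C * Rpower beta (- k)).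
  { intros beta Hbeta.
    assert (Hb1 : 1 <= beta) by (eapply Rle_trans; [apply Rmax_l | exact Hbeta]).
    assert (Hb2 : 5 / c <= beta) by (eapply Rle_trans; [apply Rmax_r | exact Hbeta]).
    assert (B := expansion_bound (hfun f) h1 h2 sigma c3 M c c' beta Hsigma Hc3 (Rlt_le _ _ HM)
      Hc D0 D1 (continuous_of_is_derive _ _ D2) X0 X1 X2 Hgrow Hup Hb2).
    unfold Vfun, Ifun, Varb, Rfun, Covb, kfun, rfun. rewrite E1, E2.
    eapply Rle_trans; [exact B |]. fold K. fold C1. unfold C.
    rewrite (Rmult_assoc C1). apply Rmult_le_compat_l; [lra |].
    replace (c * beta / 5) with (c / 5 * beta) by field.
    rewrite Rmult_plus_distr_r, !Rmult_assoc. apply Rplus_le_compat.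
    - destruct Hk as [-> | Hk]; [lra |]. apply Rmult_le_compat_l; [exact Hc3 |].
      apply inv_sqrt_pow_le; simpl; lra.
    - apply Rmult_le_compat_l; [lra |]. apply inv_sqrt_pow_le; simpl; lra. }
  split; [now exists C, (Rmax 1 (5 / c)) |].
  set (P := Phi 0 / (2 * Phi (- 1))).
  assert (HP : 0 < P).
  { generalize (Phi_pos 0) (Phi_pos (- 1)). intros. apply Rdiv_lt_0_compat; lra. }
  exists (sqrt (P * C)), (Rmax 1 (5 / c)). intros beta lhat Hbeta Hopt.
  destruct (opt_ell_lower_bound f beta lhat Hopt) as [HD Hl]. fold P in Hl.
  eapply Rle_trans; [exact Hl |].
  (* [Dfun] is the negative of the quantity bounded in [Hmain]. *)
  assert (HDC : Dfun f beta <= C * Rpower beta (- k)).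
  { eapply Rle_trans; [| apply (Hmain beta Hbeta)].
    rewrite <- Rabs_Ropp. eapply Rle_trans; [| apply Rle_abs]. unfold Dfun. lra. }
  assert (HRp : 0 < Rpower beta (- k)) by apply exp_pos.
  assert (HC0 : 0 <= C) by nra.
  rewrite <- (sqrt_pow2 (Rpower beta (- (k / 2)))) by apply Rlt_le, exp_pos.
  rewrite <- sqrt_mult_alt by (apply Rmult_le_pos; lra).
  apply sqrt_le_1_alt.
  replace (Rpower beta (- (k / 2)) ^ 2) with (Rpower beta (- k)).
  - rewrite Rmult_assoc. apply Rmult_le_compat_l; lra.
  - simpl. rewrite Rmult_1_r, <- Rpower_plus. f_equal. field.
Qed.
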